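(* Let $d\ge 1$ and let $\varphi_{\mathbb{B}^d}\colon(\mathbb{R}^d,\mu_{1})\to(\mathbb{B}^d,\mathrm{unif})$ be the mapping given by $$\varphi_{\mathbb{B}^d}(x)=\frac{x}{\|x\|}\left(\frac{\gamma\left(\frac d2,\frac{\|x\|^2}{2}\right)}{\Gamma\left(\frac d2\right)}\right)^{1/d}\quad (x\neq 0),\qquad \varphi_{\mathbb{B}^d}(0)=0.$$ Then the mapping $\Phi_{\mathbb{B}^d}=\varphi_{\mathbb{B}^d}\circ\Phi_{\mathbb{R}^d}\colon((0,1)^d,\mathrm{unif})\to(\mathbb{B}^d,\mathrm{unif})$ is measure preserving.
   Context: A bijection $\varphi\colon\Omega_1\to\Omega_2$ between measure spaces $(\Omega_1,\Sigma_1,\mu_1)$, $(\Omega_2,\Sigma_2,\mu_2)$ is measure preserving if $\varphi$ and $\varphi^{-1}$ are measurable and $\mu_2(A)=\mu_1(\varphi^{-1}(A))$ for all $A\in\Sigma_2$. $\mathbb{B}^d$ is the open unit ball of $\mathbb{R}^d$ and $\mathrm{unif}$ on it is Lebesgue measure normalized to have total mass $1$; $\mathrm{unif}$ on $(0,1)^d$ is Lebesgue measure. The measure $\mu_1$ on $\mathbb{R}^d$ is the standard Gaussian measure $d\mu_1(x)=(2\pi)^{-d/2}e^{-\|x\|^2/2}\,d\lambda(x)$, with $\lambda$ Lebesgue measure. $\gamma(t,x)=\int_0^x s^{t-1}e^{-s}\,ds$ is the incomplete gamma function. $\Phi_{\mathbb{R}^d}\colon(0,1)^d\to\mathbb{R}^d$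 is given by $\Phi_{\mathbb{R}^d}(x_1,\dots,x_d)=(\sqrt2\,\mathrm{erf}^{-1}(2x_1-1),\dots,\sqrt2\,\mathrm{erf}^{-1}(2x_d-1))$, where $\mathrm{erf}^{-1}$ is the inverse of $\mathrm{erf}\colon\mathbb{R}\to(-1,1)$, $\mathrm{erf}(t)=\frac{2}{\sqrt\pi}\int_0^te^{-s^2}\,ds$. *)

(* Defs.v *)
From HB Require Import structures.
From mathcomp Require Import all_boot all_order all_algebra.
From mathcomp Require Import all_classical all_reals all_analysis.

Set Implicit Arguments.
Unset Strict Implicit.
Unset Printing Implicit Defensive.
Import Order.TTheory GRing.Theory Num.Theory.
Import numFieldNormedType.Exports.

Local Open Scope classical_set_scope.
Local Open Scope ring_scope.

(* A measure space is a measurable subset D of an ambient measurable type, with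
   the trace sigma-algebra, together with a set function of which only the
   values on the measurable subsets of D matter.  When f is a bijection from D1
   to D2, pinv D1 f agrees on D2 with its inverse. *)
Definition measure_preserving d1 d2 (T1 : measurableType d1)
    (T2 : measurableType d2) (R : realType)
    (D1 : set T1) (mu1 : set T1 -> \bar R)
    (D2 : set T2) (mu2 : set T2 -> \bar R) (f : T1 -> T2) : Prop :=
  [/\ measurable D1 /\ measurable D2,
      set_bij D1 D2 f,
      measurable_fun D1 f,
      measurable_fun D2 (pinv D1 f) &
      forall A, measurable A -> A `<=` D2 -> mu2 A = mu1 (D1 `&` f @^-1` A)].

(* R^n is n.-tuple R, whose sigma-algebra is the product of the Borel
   sigma-algebras of the coordinates, that is, the Borel sigma-algebra. *)
Section lebesgue_tuple.
Context {R : realType}.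

Definition tuple_consp n (x : measurableTypeR R * n.-tuple R) : n.+1.-tuple R :=
  [tuple of x.1 :: x.2].

Fixpoint lebesgue_tuple n : set (n.-tuple R) -> \bar R :=
  match n with
  | 0 => \d_[tuple]
  | n'.+1 => pushforward (lebesgue_measure \x @lebesgue_tuple n')%E
               (@tuple_consp n')
  end.

Lemma measurable_tuple_consp n : measurable_fun setT (@tuple_consp n).
Proof. exact: measurable_cons. Qed.

Lemma lebesgue_tuple_sigma_finite_measure n :
  exists m : {sigma_finite_measure set (n.-tuple R) -> \bar R},
    (m : set _ -> _) = @lebesgue_tuple n.
Proof.
elim: n => [|n [m mE]] /=; first by exists (\d_([tuple] : 0.-tuple R)).
rewrite -mE.
pose mu := pushforward (lebesgue_measure \x m)%E (@tuple_consp n).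
pose mu0 : set (n.+1.-tuple R) -> \bar R := mu.
have mc := @measurable_tuple_consp n.
have mpre A : measurable A -> measurable (@tuple_consp n @^-1` A).
  by move=> mA; rewrite -[X in measurable X]setTI; exact: mc.
have p0 : mu0 set0 = 0%E by rewrite /mu0 /mu /pushforward preimage_set0 measure0.
have pge0 A : (0 <= mu0 A)%E by exact: integral_ge0.
have psa : semi_sigma_additive mu0.
  move=> F mF tF mUF; rewrite /mu0 /mu /pushforward preimage_bigcup.
  apply: measure_semi_sigma_additive.
  - by move=> k; exact: mpre.
  - apply/trivIsetP => /= i j _ _ ij; rewrite -preimage_setI.
    by move/trivIsetP : tF => /(_ _ _ _ _ ij) ->//; rewrite preimage_set0.
  - by rewrite -preimage_bigcup; exact: mpre.
pose M1 := isMeasure.Build _ _ _ mu0 p0 pge0 psa.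
pose mm : {measure set _ -> \bar R} := HB.pack mu0 M1.
have sf : sigma_finite setT mm.
  have [H HT Hoo] : sigma_finite setT (lebesgue_measure \x m)%E.
    have /sigma_finiteP[F [FT ndF Foo]] := sigma_finiteT (@lebesgue_measure R).
    have /sigma_finiteP[G [GT ndG Goo]] := sigma_finiteT m.
    exists (fun k => F k `*` G k).
      rewrite -setXTT FT GT predeqE => -[x y]; split.
        move=> [/= [i _ Fx] [k _ Gy]]; exists (maxn i k) => //; split.
        - by move: x Fx; exact/subsetPset/ndF/leq_maxl.
        - by move: y Gy; exact/subsetPset/ndG/leq_maxr.
      by move=> [i _ []/= ? ?]; split; exists i.
    move=> k; have [? ?] := Foo k; have [? ?] := Goo k.
    split; first exact: measurableX.
    by rewrite product_measure1E// lte_mul_pinfty// ge0_fin_numE.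
  exists (fun k => (fun x => (thead x, [tuple of behead x])) @^-1` H k).
    apply/seteqP; split=> // x _.
    have : setT (thead x, [tuple of behead x]) by [].
    by rewrite HT => -[k _ Hk]; exists k.
  move=> k; have [mH Hlt] := Hoo k; split.
    rewrite -[X in measurable X]setTI.
    have mhb : measurable_fun setT (fun x : n.+1.-tuple R =>
        (thead x : measurableTypeR R, [tuple of behead x] : n.-tuple R)).
      apply: measurable_fun_pair; last exact: measurable_behead.
      exact: (@measurable_tnth _ R n.+1 ord0).
    exact: mhb.
  rewrite /mm/= /mu0 /mu /pushforward -comp_preimage.
  rewrite (_ : _ @^-1` _ = H k)//; apply/seteqP; split=> -[a t]/=.
    by rewrite theadE (_ : [tuple of _] = t)//; exact: val_inj.
  by rewrite theadE (_ : [tuple of _] = t)//; exact: val_inj.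
pose M2 := Measure_isSigmaFinite.Build _ _ _ mm sf.
pose mf : {sigma_finite_measure set (n.+1.-tuple R) -> \bar R} :=
  HB.pack mu0 M1 M2.
by exists mf.
Qed.

Section instances.
Variable n : nat.
Local Notation mu := (@lebesgue_tuple n).

Let mu0 : mu set0 = 0%E.
Proof. by have [m <-] := lebesgue_tuple_sigma_finite_measure n. Qed.

Let mu_ge0 A : (0 <= mu A)%E.
Proof. by have [m <-] := lebesgue_tuple_sigma_finite_measure n. Qed.

Let mu_sigma_additive : semi_sigma_additive mu.
Proof.
have [m <-] := lebesgue_tuple_sigma_finite_measure n.
exact: measure_semi_sigma_additive.
Qed.

HB.instance Definition _ := isMeasure.Build _ _ _ mu
  mu0 mu_ge0 mu_sigma_additive.

Let mu_sigma_finite : sigma_finite setT mu.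
Proof.
have [m <-] := lebesgue_tuple_sigma_finite_measure n.
exact: sigma_finiteT.
Qed.

HB.instance Definition _ := Measure_isSigmaFinite.Build _ _ _ mu
  mu_sigma_finite.

End instances.

Lemma lebesgue_tuple_box n (A : 'I_n -> set R) :
  (forall i, measurable (A i)) ->
  lebesgue_tuple [set x : n.-tuple R | forall i, A i (tnth x i)] =
  (\prod_(i < n) lebesgue_measure (A i))%E.
Proof.
elim: n A => [|n IH] A mA.
  by rewrite big_ord0/= diracE mem_set// => -[].
rewrite big_ord_recl/= -IH//.
rewrite -(product_measure1E lebesgue_measure (@lebesgue_tuple n))//; last first.
  rewrite (_ : [set _ | _] =
      \bigcap_(i in [set: 'I_n]) ((fun x => tnth x i) @^-1` A (lift ord0 i))).
    apply: fin_bigcap_measurable => // i _.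
    by rewrite -[X in measurable X]setTI; exact: measurable_tnth.
  by apply/seteqP; split=> x /= xA i => [_|]; exact: xA.
  exact: mA.
rewrite /pushforward; congr ((_ \x _)%E _); apply/seteqP; split=> -[a t]/=.
  move=> atA; split; first exact: (atA ord0).
  by move=> i; have := atA (lift ord0 i); rewrite tnthS.
move=> [Aa At] i; have [j ->|->//] := unliftP ord0 i.
by rewrite tnthS; exact: At.
Qed.

End lebesgue_tuple.

Section transport_map.
Context {R : realType}.
Local Notation mu := (@lebesgue_measure R).

Definition incomplete_gamma (t x : R) : R :=
  \int[mu]_(s in `]0, x]) (s `^ (t - 1) * expR (- s)).

Definition Gamma (t : R) : R :=
  \int[mu]_(s in `]0, +oo[) (s `^ (t - 1) * expR (- s)).

(* The integral from 0 to t is oriented, so it changes sign for t < 0. *)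
Definition erf (t : R) : R :=
  2 / Num.sqrt pi *
  (if 0 <= t then \int[mu]_(s in `[0, t]) expR (- s ^+ 2)
   else - \int[mu]_(s in `[t, 0]) expR (- s ^+ 2)).

(* The inverse of erf on its range `]-1, 1[; its other values are junk. *)
Definition erfinv : R -> R := pinv setT erf.

Variable d : nat.
Implicit Type x : d.-tuple R.

Definition enorm x : R := Num.sqrt (\sum_(i < d) tnth x i ^+ 2).

Definition unit_cube : set (d.-tuple R) :=
  [set x | forall i, 0 < tnth x i < 1].

Definition unit_ball : set (d.-tuple R) := [set x | enorm x < 1].

Definition unif_ball (A : set (d.-tuple R)) : \bar R :=
  (lebesgue_tuple (A `&` unit_ball) / lebesgue_tuple unit_ball)%E.

Definition Phi_R x : d.-tuple R :=
  [tuple Num.sqrt 2 * erfinv (2 * tnth x i - 1) | i < d].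

Definition phi_ball x : d.-tuple R :=
  if x == [tuple 0 | i < d] then [tuple 0 | i < d] else
  [tuple tnth x i / enorm x *
     (incomplete_gamma (d%:R / 2) (enorm x ^+ 2 / 2) / Gamma (d%:R / 2))
       `^ (d%:R^-1) | i < d].

End transport_map.

(* Main.v *)
From HB Require Import structures.
Require Import Defs.
From mathcomp Require Import all_boot all_order all_algebra.
From mathcomp Require Import all_classical all_reals all_analysis.
From mathcomp Require Import measurable_realfun gauss_integral ring lra.

Set Implicit Arguments.
Unset Strict Implicit.
Unset Printing Implicit Defensive.
Import Order.TTheory GRing.Theory Num.Theory.
Import numFieldNormedType.Exports.

Local Open Scope classical_set_scope.
Local Open Scope ring_scope.

(** The point of the proof is that the Gaussian measure is a halfway house
between the cube and the ball: it is at once a product measure and a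
rotation-invariant one.

On the product side, [(erf + 1) / 2] is the distribution function of the density
[exp (- x ^ 2) / sqrt pi], and [erfinv (2 v - 1)] is its quantile function, so it
sends the uniform law on the unit interval to that density
([transports_quantile], [erfinv_quantile]).  By Tonelli the coordinatewise map
sends the uniform law on the cube to the law of density
[pi ^ (- d / 2) exp (- ||y|| ^ 2)] ([transports_tuple], [integral_cube_gauss]).
The factor [sqrt 2] in [Phi_R] is absorbed in [phi_ball], which halves the squared
norm ([phi_ball_scale]); what is left of [phi_ball] is the radial map
[y |-> (y / ||y||) * F (||y|| ^ 2) ^ (1 / d)], where [F] is the distribution
function of the Gamma law of shape [t = d / 2].

On the radial side, polar coordinates are obtained without any Jacobian.  Since
Lebesgue measure is homogeneous of degree [d], the set of points of direction in
[E] with [||x|| ^ d < b] has measure [b * sigma E], where [sigma E] is the measure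
of the part of the unit ball with direction in [E] ([lebesgue_tuple_sector]).
Hence [x |-> (||x|| ^ d, x / ||x||)] maps Lebesgue measure to the product of
Lebesgue measure on the positive half-line and [sigma] ([integral_polar]), and
[x |-> (||x|| ^ 2, x / ||x||)] maps it to the product of [t u ^ (t - 1) du] and
[sigma] ([integral_radial]).  In the latter coordinates the Gaussian density
becomes a multiple of the density of the Gamma law, which [F] transports to the
uniform law on the unit interval, so [u |-> F u ^ (1 / d)] yields exactly the
radial part [w ^ (1 / d)], with [w] uniform, of the uniform law on the ball
([integral_gauss_radial_map]).

Only one constant has to be identified, and it comes from total masses: the
Gaussian law has the mass 1 of the cube.  The same identity shows that the
integral defining [Gamma t] is finite and positive ([gauss_const_ball]).
Bijectivity holds because both the Gaussian and the Gamma distribution functions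
are strictly increasing bijections onto the open unit interval. *)

(** * Transport of weighted measures *)

(** The image of the weighted measure [k mu] under [phi] is [h nu].  It is stated
on integrals of nonnegative functions and not on sets, so that it can be iterated
with Tonelli's theorem; the weight [k] makes it possible to restrict [mu] to a
subset without changing the underlying type. *)
Definition transports d1 d2 (X : measurableType d1) (Y : measurableType d2)
    (R : realType) (mu : set X -> \bar R) (k : X -> R) (phi : X -> Y)
    (nu : set Y -> \bar R) (h : Y -> R) : Prop :=
  forall g : Y -> \bar R, measurable_fun setT g -> (forall y, 0 <= g y)%E ->
    (\int[mu]_x (g (phi x) * (k x)%:E) = \int[nu]_y (g y * (h y)%:E))%E.

Section measures_from_integrals.
Local Open Scope ereal_scope.
Context d (X : measurableType d) (R : realType).
Implicit Types (mu : {measure set X -> \bar R}).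

Lemma exists_pushforward_density d' (Y : measurableType d') mu (k : X -> R)
    (phi : X -> Y) : measurable_fun setT k -> (forall x, 0 <= k x)%R ->
    measurable_fun setT phi ->
  exists m : {measure set Y -> \bar R},
    forall A, m A = \int[mu]_(x in phi @^-1` A) (k x)%:E.
Proof.
move=> mk k0 mphi.
have mpre A : measurable A -> measurable (phi @^-1` A).
  by move=> mA; rewrite -[X in measurable X]setTI; exact: mphi.
pose m0 A := \int[mu]_(x in phi @^-1` A) (k x)%:E.
have m00 : m0 set0 = 0 by rewrite /m0 preimage_set0 integral_set0.
have m0ge0 A : 0 <= m0 A by apply: integral_ge0 => x _; rewrite lee_fin.
have m0sa : semi_sigma_additive m0.
  move=> F mF tF mUF; rewrite /m0 preimage_bigcup.
  rewrite ge0_integral_bigcup//.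
  - by apply: is_cvg_ereal_nneg_natsum_cond => n _ _; exact: m0ge0.
  - by move=> n; exact: mpre.
  - by apply/measurable_EFinP; exact: measurable_funTS.
  - by move=> x _; rewrite lee_fin.
  - apply/trivIsetP => /= i j _ _ ij; rewrite -preimage_setI.
    by move/trivIsetP : tF => /(_ _ _ _ _ ij) ->//; rewrite preimage_set0.
pose m : {measure set Y -> \bar R} :=
  HB.pack m0 (isMeasure.Build _ _ _ m0 m00 m0ge0 m0sa).
by exists m.
Qed.

Lemma integral_indicM mu (k : X -> R) (A : set X) : measurable A ->
  \int[mu]_x ((\1_A x)%:E * (k x)%:E) = \int[mu]_(x in A) (k x)%:E.
Proof.
move=> mA; rewrite [RHS]integral_mkcond; apply: eq_integral => x _.
by rewrite epatch_indic muleC.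
Qed.

Lemma integral_cst_EFin mu (c : R) (A : set X) : measurable A ->
  \int[mu]_(x in A) (cst c x)%:E = c%:E * mu A.
Proof. by move=> mA; exact: (@integral_cst _ _ _ mu A mA c%:E). Qed.

End measures_from_integrals.

Section integral_comp_approx.
Local Open Scope ereal_scope.
Import HBNNSimple.

(** Both sides of a transport identity are limits of their values on the simple
functions approximating [g], with the same approximations on both sides. *)
Lemma integral_comp_approx d1 d2 (X : measurableType d1) (Y : measurableType d2)
    (R : realType) (mu : {measure set X -> \bar R}) (k : X -> R) (phi : X -> Y)
    (mk : measurable_fun setT k) (k0 : forall x, (0 <= k x)%R)
    (mphi : measurable_fun setT phi) (g : Y -> \bar R) (mg : measurable_fun setT g) :
  (forall y, 0 <= g y) ->
  \int[mu]_x (g (phi x) * (k x)%:E) = limn (fun n =>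
    \int[mu]_x ((nnsfun_approx measurableT mg n (phi x))%:E * (k x)%:E)).
Proof.
move=> g0; pose f := nnsfun_approx measurableT mg.
rewrite -monotone_convergence//.
- apply: eq_integral => x _; apply/esym/cvg_lim => //.
  by apply: cvgeZr => //; apply: cvg_nnsfun_approx.
- move=> n; apply: emeasurable_funM; last exact/measurable_EFinP.
  by apply/measurable_EFinP; apply: measurableT_comp.
- by move=> n x _; rewrite mule_ge0// lee_fin.
- move=> x _ m n mn; apply: lee_wpmul2r; first by rewrite lee_fin.
  by rewrite lee_fin; exact/lefP/nd_nnsfun_approx.
Qed.

End integral_comp_approx.

Section transports_theory.
Local Open Scope ereal_scope.
Context d1 d2 (X : measurableType d1) (Y : measurableType d2) (R : realType).
Variables (mu : {measure set X -> \bar R}) (k : X -> R) (phi : X -> Y).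
Variables (nu : {measure set Y -> \bar R}) (h : Y -> R).
Hypotheses (mk : measurable_fun setT k) (k0 : forall x, (0 <= k x)%R).
Hypotheses (mh : measurable_fun setT h) (h0 : forall x, (0 <= h x)%R).
Hypothesis mphi : measurable_fun setT phi.

Import HBNNSimple.

(** Transport needs to be checked only on indicators, by linearity and monotone
convergence. *)
Lemma transports_indic :
  (forall A, measurable A ->
    \int[mu]_(x in phi @^-1` A) (k x)%:E = \int[nu]_(y in A) (h y)%:E) ->
  transports mu k phi nu h.
Proof.
move=> H g mg g0; rewrite (integral_comp_approx mu mk k0 mphi mg g0).
rewrite (integral_comp_approx nu mh h0 (@measurable_id _ _ _) mg g0).
congr (limn _); apply/funext => n; set f := nnsfun_approx _ _ _.
have mpre A : measurable A -> measurable (phi @^-1` A).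
  by move=> mA; rewrite -[X in measurable X]setTI; exact: mphi.
have mA r : measurable (f @^-1` [set r]) by exact: measurable_funPTI.
have fE y : (f y)%:E =
    \sum_(r \in range f) (r * \1_(f @^-1` [set r]) y)%:E.
  by rewrite fimfunE -fsumEFin.
transitivity (\sum_(r \in range f)
    \int[mu]_x (r%:E * ((\1_(phi @^-1` (f @^-1` [set r])) x)%:E * (k x)%:E))).
  rewrite -ge0_integral_fsum//.
  - apply: eq_integral => x _; rewrite fE ge0_mule_fsuml; last first.
      by move=> r; rewrite EFinM nnfun_muleindic_ge0.
    by apply: eq_fsbigr => r _; rewrite EFinM -muleA.
  - move=> r; apply: emeasurable_funM => //.
    apply: emeasurable_funM; apply/measurable_EFinP => //.
    by apply: measurable_indic; exact: mpre.
  - move=> r x _; rewrite muleA mule_ge0 ?lee_fin//.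
    exact: (nnfun_muleindic_ge0 f r (phi x)).
transitivity (\sum_(r \in range f)
    \int[nu]_y (r%:E * ((\1_(f @^-1` [set r]) y)%:E * (h y)%:E))); last first.
  rewrite -ge0_integral_fsum//.
  - apply: eq_integral => x _; rewrite fE ge0_mule_fsuml; last first.
      by move=> r; rewrite EFinM nnfun_muleindic_ge0.
    by apply: eq_fsbigr => r _; rewrite EFinM -muleA.
  - move=> r; apply: emeasurable_funM => //.
    by apply: emeasurable_funM; apply/measurable_EFinP => //; exact: measurable_indic.
  - move=> r y _; rewrite muleA mule_ge0 ?lee_fin//.
    exact: (nnfun_muleindic_ge0 f r y).
apply: eq_fsbigr => r; rewrite inE => -[y _ fyr].
have r0 : 0 <= r%:E by rewrite -fyr lee_fin.
rewrite !ge0_integralZl//; first last.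
- by move=> x _; rewrite mule_ge0// lee_fin.
- apply: emeasurable_funM; apply/measurable_EFinP => //.
  by apply: measurable_indic; exact: mpre.
- by move=> y' _; rewrite mule_ge0// lee_fin.
- apply: emeasurable_funM; apply/measurable_EFinP => //.
by rewrite !integral_indicM ?H//; exact: mpre.
Qed.

End transports_theory.

Section real_line.
Local Open Scope ereal_scope.
Context {R : realType}.
Local Notation lambda := (@lebesgue_measure R).

(** The open lower half-lines form a generating pi-system that covers the line,
so locally finite distribution functions determine measures. *)
Lemma measure_unique_itvNyo (m1 m2 : {measure set (measurableTypeR R) -> \bar R}) :
  (forall b, m1 `]-oo, b[%classic = m2 `]-oo, b[%classic) ->
  (forall b, m1 `]-oo, b[%classic < +oo) ->
  forall A, measurable A -> m1 A = m2 A.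
Proof.
move=> m12 m1oo; pose g n : set (measurableTypeR R) := `]-oo, n%:R[%classic.
apply: (@measure_unique _ R (measurableTypeR R)
  (@RGenInftyO.G R) g _ _ _ _ m1 m2) => //.
- exact: RGenInftyO.measurableE.
- move=> _ _ [x ->] [y ->]; exists (Num.min x y).
  by apply/seteqP; split => z; rewrite /= !in_itv/= lt_min => /andP.
- by move=> n; exists n%:R.
- apply/seteqP; split => // x _.
  by exists (Num.truncn x).+1 => //; rewrite /g/= in_itv/= truncnS_gt.
- by move=> _ [b ->].
- by move=> n; exact: m1oo.
Qed.

Lemma transports_itvNyo d (X : measurableType d)
    (mu : {measure set X -> \bar R}) (k : X -> R) (phi : X -> R) (h : R -> R) :
  measurable_fun setT k -> (forall x, 0 <= k x)%R ->
  measurable_fun setT h -> (forall x, 0 <= h x)%R -> measurable_fun setT phi ->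
  (forall b, \int[mu]_(x in [set x | (phi x < b)%R]) (k x)%:E =
             \int[lambda]_(y in `]-oo, b[) (h y)%:E) ->
  (forall b, \int[lambda]_(y in `]-oo, b[) (h y)%:E < +oo) ->
  transports mu k (phi : X -> measurableTypeR R) lambda h.
Proof.
move=> mk k0 mh h0 mphi H Hoo; apply: transports_indic => //.
have [m mE] := exists_pushforward_density mu (Y := measurableTypeR R) mk k0 mphi.
have [m' m'E] := exists_pushforward_density lambda (Y := measurableTypeR R)
  (phi := idfun) mh h0 (@measurable_id _ _ _).
move=> A mA; rewrite -mE.
rewrite -[RHS]/(\int[lambda]_(x in idfun @^-1` A) (h x)%:E) -m'E.
have preE b : phi @^-1` `]-oo, b[%classic = [set x | (phi x < b)%R].
  by apply/seteqP; split => x /=; rewrite in_itv.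
apply: measure_unique_itvNyo => // b.
  by rewrite mE m'E preE H.
by rewrite mE preE H.
Qed.

End real_line.

(** * Products of one-dimensional transports *)

Section tuples.
Local Open Scope ereal_scope.
Context {R : realType}.
Local Notation lambda := (@lebesgue_measure R).
Local Notation lambdan := (@lebesgue_tuple R _).

Lemma measurable_map_tuple n (phi : R -> R) : measurable_fun setT phi ->
  measurable_fun setT (map_tuple phi : n.-tuple R -> n.-tuple R).
Proof.
move=> mphi; apply/measurable_fun_tnthP => i.
rewrite (_ : _ \o _ = phi \o (fun x : n.-tuple R => tnth x i)); last first.
  by apply/funext => x /=; rewrite tnth_map.
by apply: measurableT_comp => //; exact: measurable_tnth.
Qed.

Lemma measurable_prod_tnth n (h : R -> R) : measurable_fun setT h ->
  measurable_fun setT (fun x : n.-tuple R => \prod_(i < n) h (tnth x i))%R.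
Proof.
move=> mh; apply: measurable_prod => i _.
by apply: measurableT_comp => //; exact: measurable_tnth.
Qed.

Lemma integral_lebesgue_tupleS n (g : n.+1.-tuple R -> \bar R) :
  measurable_fun setT g -> (forall x, 0 <= g x) ->
  \int[lambdan]_x g x = \int[lambda]_a \int[lambdan]_t g (tuple_consp (a, t)).
Proof.
move=> mg g0.
transitivity (\int[pushforward (lambda \x @lebesgue_tuple R n)
  (@tuple_consp R n)]_x g x); first by [].
rewrite ge0_integral_pushforward//; last exact: measurable_tuple_consp.
rewrite preimage_setT fubini_tonelli1//; last by move=> z; exact: g0.
by apply: measurableT_comp => //; exact: measurable_tuple_consp.
Qed.

Lemma measurable_tuple_consp2 n (a : R) :
  measurable_fun setT (fun t : n.-tuple R => tuple_consp (a, t)).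
Proof.
by apply: measurableT_comp; [exact: measurable_tuple_consp|exact: measurable_pair1].
Qed.

(** Peeling off one coordinate at a time: Tonelli turns the integral over tuples
into an iterated one, whose inner part is handled by the induction hypothesis and
whose outer part is the one-dimensional transport. *)
Lemma transports_tuple n (k phi h : R -> R) :
  measurable_fun setT k -> (forall x, 0 <= k x)%R ->
  measurable_fun setT h -> (forall x, 0 <= h x)%R -> measurable_fun setT phi ->
  transports lambda k (phi : measurableTypeR R -> measurableTypeR R) lambda h ->
  transports (@lebesgue_tuple R n) (fun x => \prod_(i < n) k (tnth x i))%R
    (map_tuple phi) (@lebesgue_tuple R n) (fun y => \prod_(i < n) h (tnth y i))%R.
Proof.
move=> mk k0 mh h0 mphi kh; elim: n => [|n IH] g mg g0.
  rewrite /= !integral_dirac//=.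
  - by rewrite (_ : map_tuple _ _ = [tuple])//; [rewrite !big_ord0|exact: val_inj].
  - apply: emeasurable_funM => //; apply/measurable_EFinP.
    exact: measurable_prod_tnth.
  - apply: emeasurable_funM.
      by apply: measurableT_comp => //; exact: measurable_map_tuple.
    apply/measurable_EFinP; exact: measurable_prod_tnth.
have consE (f : R -> R) (a : R) (t : n.-tuple R) :
    (\prod_(i < n.+1) f (tnth (tuple_consp (a, t)) i))%:E =
    (\prod_(i < n) f (tnth t i))%:E * (f a)%:E.
  rewrite big_ord_recl -EFinM mulrC; congr (_ * _)%:E.
  by apply: eq_bigr => i _; rewrite tnthS.
have mapE (a : R) (t : n.-tuple R) :
    map_tuple phi (tuple_consp (a, t)) = tuple_consp (phi a, map_tuple phi t).
  exact: val_inj.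
have pr0 (f : R -> R) (f0 : forall x, (0 <= f x)%R) m (t : m.-tuple R) :
    0 <= (\prod_(i < m) f (tnth t i))%:E.
  by rewrite lee_fin; apply: prodr_ge0.
have mpr (f : R -> R) m : measurable_fun setT f ->
    measurable_fun setT (fun t : m.-tuple R => (\prod_(i < m) f (tnth t i))%:E).
  by move=> mf; apply/measurable_EFinP; exact: measurable_prod_tnth.
have mg2 : measurable_fun setT (g \o @tuple_consp R n).
  by apply: measurableT_comp => //; exact: measurable_tuple_consp.
rewrite integral_lebesgue_tupleS; last 2 first.
- apply: emeasurable_funM; last exact: mpr.
  by apply: measurableT_comp => //; exact: measurable_map_tuple.
- by move=> x; rewrite mule_ge0// pr0.
rewrite [RHS]integral_lebesgue_tupleS; last 2 first.
- by apply: emeasurable_funM => //; exact: mpr.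
- by move=> x; rewrite mule_ge0// pr0.
pose G a := \int[lambdan]_(t in [set: n.-tuple R])
  (g (tuple_consp (a, t)) * (\prod_(i < n) h (tnth t i))%:E).
have ga a : measurable_fun setT (fun t : n.-tuple R => g (tuple_consp (a, t))).
  by apply: measurableT_comp => //; exact: measurable_tuple_consp2.
transitivity (\int[lambda]_a (G (phi a) * (k a)%:E)).
  apply: eq_integral => a _.
  under eq_integral do rewrite consE mapE muleA.
  rewrite ge0_integralZr//.
  - by rewrite (IH (fun t => g (tuple_consp (phi a, t)))).
  - apply: emeasurable_funM; last exact: mpr.
    by apply: measurableT_comp (ga _) _; exact: measurable_map_tuple.
  - by move=> t _; rewrite mule_ge0// pr0.
  - by rewrite lee_fin.
rewrite kh.
- apply: eq_integral => a _; rewrite -ge0_integralZr//.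
  + by apply: eq_integral => t _; rewrite consE muleA.
  + by apply: emeasurable_funM => //; exact: mpr.
  + by move=> t _; rewrite mule_ge0// pr0.
  + by rewrite lee_fin.
- pose F (z : measurableTypeR R * n.-tuple R) :=
    g (tuple_consp z) * (\prod_(i < n) h (tnth z.2 i))%:E.
  apply: (@measurable_fun_fubini_tonelli_F _ _ _ _ _ (@lebesgue_tuple R n) F).
  + apply: emeasurable_funM => //.
    exact: (measurableT_comp (mpr h n mh) measurable_snd).
  + by move=> z; rewrite mule_ge0// pr0.
- by move=> a; apply: integral_ge0 => t _; rewrite mule_ge0// pr0.
Qed.

End tuples.

(** * Distribution and quantile functions *)

Section galois.
Context {R : realType}.
Local Notation lambda := (@lebesgue_measure R).

Lemma measurable_galois (J : set R) (Q F : R -> R) : measurable J ->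
  (forall w b, J w -> (Q w < b) = (w < F b)) -> measurable_fun J Q.
Proof.
move=> mJ QF; apply: (measurability (@RGenInftyO.G R)) => [|/= _ [_] [r] -> <-].
  exact: RGenInftyO.measurableE.
rewrite (_ : J `&` _ = J `&` `]-oo, F r[%classic); first exact: measurableI.
by apply/seteqP; split=> w /=; rewrite !in_itv/= => -[Jw]; rewrite (QF _ _ Jw).
Qed.

(** The equivalence [Q w < b <-> w < F b] says that [Q] pulls lower half-lines
back to lower half-lines; this is all that the quantile transform needs, be the
mass finite or infinite. *)
Lemma transports_galois (J : set R) (Q F f : R -> R) : measurable J ->
  measurable_fun setT Q -> measurable_fun setT f -> (forall x, 0 <= f x) ->
  (forall w b, J w -> (Q w < b) = (w < F b)) ->
  (forall b, lambda (J `&` `]-oo, F b[) = \int[lambda]_(x in `]-oo, b[) (f x)%:E)%E ->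
  (forall b, lambda (J `&` `]-oo, F b[) < +oo)%E ->
  transports lambda (\1_J : R -> R)
    (Q : measurableTypeR R -> measurableTypeR R) lambda f.
Proof.
move=> mJ mQ mf f0 QF lF Foo; apply: transports_itvNyo => //.
- move=> b; rewrite integral_indic//; last first.
    rewrite (_ : [set _ | _] = Q @^-1` `]-oo, b[%classic); last first.
      by apply/seteqP; split=> w; rewrite /= in_itv.
    by rewrite -[X in measurable X]setTI; exact: mQ.
  rewrite -lF; congr (lambda _); apply/seteqP; split=> w; rewrite /= in_itv/=;
    by move=> [Jw]; rewrite (QF _ _ Jw).
- by move=> b; rewrite -lF.
Qed.

End galois.

Section distribution_function.
Context {R : realType}.
Local Notation lambda := (@lebesgue_measure R).

(** Probability densities that are positive exactly on an open upper ray, which may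
be the whole line: this covers the Gaussian and the Gamma laws, and makes the
distribution function strictly increasing on the ray. *)
Definition ray_density (f : R -> R) : Prop :=
  [/\ measurable_fun setT f, forall x, 0 <= f x,
      (\int[lambda]_x (f x)%:E = 1)%E,
      forall x y, x <= y -> 0 < f x -> 0 < f y &
      forall x, 0 < f x -> exists2 y, y < x & 0 < f y].

Variable f : R -> R.
Hypothesis fP : ray_density f.

Let mf : measurable_fun setT f. Proof. by case: fP. Qed.
Let f0 x : 0 <= f x. Proof. by case: fP. Qed.
Let f1 : (\int[lambda]_x (f x)%:E = 1)%E. Proof. by case: fP. Qed.
Let f_up x y : x <= y -> 0 < f x -> 0 < f y.
Proof. by case: fP => _ _ _ + _; apply. Qed.
Let f_open x : 0 < f x -> exists2 y, y < x & 0 < f y.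
Proof. by case: fP => _ _ _ _; apply. Qed.

Definition distribution_function (b : R) : R :=
  \int[lambda]_(x in `]-oo, b]) f x.

Local Notation F := distribution_function.

Lemma integrable_density : lambda.-integrable setT (EFin \o f).
Proof.
apply/integrableP; split; first exact/measurable_EFinP.
by under eq_integral do rewrite /= ger0_norm//; rewrite f1 ltry.
Qed.

Let integrable_f (A : set R) : measurable A -> lambda.-integrable A (EFin \o f).
Proof. by move=> mA; apply: integrableS integrable_density. Qed.

Lemma distribution_functionE b :
  (\int[lambda]_(x in `]-oo, b]) (f x)%:E = (F b)%:E)%E.
Proof.
rewrite /F /Rintegral fineK//; apply: integrable_fin_num => //.
exact: integrable_f.
Qed.

Lemma distribution_functionEo b :
  (\int[lambda]_(x in `]-oo, b[) (f x)%:E = (F b)%:E)%E.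
Proof.
rewrite -distribution_functionE integral_itv_bndo_bndc//.
by apply/measurable_EFinP; exact: measurable_funTS.
Qed.

Lemma distribution_functionB x y : x <= y ->
  F y - F x = \int[lambda]_(t in `]x, y]) f t.
Proof. by move=> xy; rewrite /F Rintegral_itvB//; exact: integrable_f. Qed.

Lemma distribution_function_le x y : x <= y -> F x <= F y.
Proof.
by move=> xy; rewrite -subr_ge0 distribution_functionB// Rintegral_ge0.
Qed.

Lemma measurable_distribution_function : measurable_fun setT F.
Proof.
by apply: nondecreasing_measurable => // x y; exact: distribution_function_le.
Qed.

(** Openness of the ray provides an interval on the left of [y] where [f] is
positive, and the integral over it cannot vanish. *)
Lemma distribution_function_lt x y : x < y -> 0 < f y -> F x < F y.
Proof.
move=> xy /f_open[y0 y0y fy0]; pose z := Num.max x y0.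
have zy : z < y by rewrite gt_max xy.
apply: (@le_lt_trans _ _ (F z)).
  by apply: distribution_function_le; rewrite le_max lexx.
rewrite -subr_gt0 distribution_functionB ?ltW// lt_neqAle Rintegral_ge0// andbT.
apply/eqP => /esym I0.
have {}I0 : (\int[lambda]_(t in `]z, y]) `|(EFin \o f) t| = 0)%E.
  under eq_integral do rewrite /= ger0_norm//.
  rewrite -[LHS]fineK ?[X in X%:E]I0//.
  by apply: integrable_fin_num => //; exact: integrable_f.
have mf' : measurable_fun `]z, y] (EFin \o f).
  by apply/measurable_EFinP; exact: measurable_funTS.
have [N [mN N0 sN]] := (ae_eq_integral_abs lambda (measurable_itv _) mf').1 I0.
have : (lambda `]z, y] <= lambda N)%E.
  apply: le_measure; rewrite ?inE// => t /= tzy; apply: sN => /= /(_ tzy)[] ft0.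
  have : 0 < f t.
    apply: f_up fy0; move: tzy; rewrite in_itv/= => /andP[zt _].
    by rewrite (le_trans _ (ltW zt))// le_max lexx orbT.
  by rewrite ft0 ltxx.
by rewrite N0 lebesgue_measure_itv/= lte_fin zy -EFinB lee_fin subr_le0 leNgt zy.
Qed.

Lemma distribution_function_gt0 x : 0 < f x -> 0 < F x.
Proof.
move=> fx; have [y yx _] := f_open fx.
by rewrite (le_lt_trans _ (distribution_function_lt yx fx))// Rintegral_ge0.
Qed.

Lemma distribution_function_le1 x : F x <= 1.
Proof.
rewrite -lee_fin -distribution_functionE -f1; apply: ge0_subset_integral => //.
- exact/measurable_EFinP.
- by move=> y _; rewrite lee_fin.
Qed.

Lemma distribution_function_lt1 x : F x < 1.
Proof.
have [fx|fx] := ltP 0 (f (x + 1)).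
  rewrite (lt_le_trans (distribution_function_lt _ fx) (distribution_function_le1 _))//.
  by rewrite ltrDl.
rewrite /F /Rintegral integral0_eq//= => y; rewrite in_itv/= => yx.
congr EFin; apply/eqP; rewrite eq_le f0 andbT leNgt; apply/negP => fy.
by move: fx; rewrite leNgt (f_up _ fy)// (le_trans yx)// lerDl.
Qed.

Lemma distribution_function_eq0 x : f x = 0 -> F x = 0.
Proof.
move=> fx; rewrite /F /Rintegral integral0_eq//= => y; rewrite in_itv/= => yx.
congr EFin; apply/eqP; rewrite eq_le f0 andbT leNgt; apply/negP => fy.
by have := f_up yx fy; rewrite fx ltxx.
Qed.

Lemma distribution_function_continuous a b : a <= b ->
  {within `[a, b], continuous F}.
Proof.
move=> ab.
have : {within `[a, b], continuous
    (fun x => F a + parameterized_integral lambda a x f)}.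
  move=> x; apply: cvgD; first exact: cvg_cst.
  by apply: parameterized_integral_continuous => //; exact: integrable_f.
apply: subspace_eq_continuous => x; rewrite inE/= in_itv/= => /andP[ax xb].
rewrite /from_subspace /parameterized_integral/= -Rintegral_itv_obnd_cbnd.
  by rewrite -distribution_functionB// addrC subrK.
exact: integrable_f.
Qed.

(** The intermediate value theorem applies, the limits 0 and 1 at the two ends being
given by monotone convergence. *)
Lemma distribution_function_surj v : 0 < v < 1 -> exists2 x, 0 < f x & F x = v.
Proof.
move=> /andP[v0 v1].
have mEf A : measurable A -> measurable_fun A (EFin \o f).
  by move=> mA; apply/measurable_EFinP; exact: measurable_funTS.
have [b vb] : exists b, v < F b.
  apply/not_existsP => H.
  have : (\int[lambda]_(x in `]-oo, n%:R]) (f x)%:E @[n --> \oo] --> 1)%E.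
    rewrite -f1 (_ : setT = \bigcup_n `]-oo, n%:R : R]%classic).
      apply: ge0_nondecreasing_set_cvg_integral => //.
      - move=> m n mn; apply/subsetPset => x /=; rewrite !in_itv/= => /le_trans.
        by apply; rewrite ler_nat.
      - by move=> n; exact: mEf.
      - by move=> n x _; rewrite lee_fin.
    apply/seteqP; split => // x _; exists (Num.truncn x).+1 => //=.
    by rewrite in_itv/= ltW// truncnS_gt.
  move=> cv; have := cvg_lim (@ereal_hausdorff R) cv.
  have : (limn (fun n => \int[lambda]_(x in `]-oo, n%:R]) (f x)%:E) <= v%:E)%E.
    apply: lime_le; first by apply/cvg_ex; exists 1%E.
    apply: nearW => n; rewrite distribution_functionE lee_fin leNgt.
    by apply/negP; exact: H.
  by move=> /[swap] ->; rewrite lee_fin leNgt v1.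
have [a av] : exists a, F a < v.
  apply/not_existsP => H.
  have : (\int[lambda]_(x in `](- n%:R)%R, +oo[) (f x)%:E @[n --> \oo] --> 1)%E.
    rewrite -f1 (_ : setT = \bigcup_n `](- n%:R) : R, +oo[%classic).
      apply: ge0_nondecreasing_set_cvg_integral => //.
      - move=> m n mn; apply/subsetPset => x /=; rewrite !in_itv/= !andbT.
        by apply: le_lt_trans; rewrite lerN2 ler_nat.
      - by move=> n; exact: mEf.
      - by move=> n x _; rewrite lee_fin.
    apply/seteqP; split => // x _; exists (Num.truncn (- x)).+1 => //=.
    by rewrite in_itv/= andbT ltrNl truncnS_gt.
  move=> cv; have := cvg_lim (@ereal_hausdorff R) cv.
  have : (limn (fun n => \int[lambda]_(x in `](- n%:R)%R, +oo[) (f x)%:E) <=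
      (1 - v)%:E)%E.
    apply: lime_le; first by apply/cvg_ex; exists 1%E.
    apply: nearW => n; rewrite -[leLHS]fineK; last first.
      by apply: integrable_fin_num => //; exact: integrable_f.
    suff : \int[lambda]_(x in `](- n%:R), +oo[) f x <= 1 - v by [].
    rewrite -(@Rintegral_itvB _ f -oo%O +oo%O)//.
      rewrite set_itvNyy /Rintegral f1/= lerB// leNgt.
      by apply/negP; exact: H.
    exact: integrable_f.
  by move=> /[swap] ->; rewrite lee_fin; lra.
have ab : a <= b.
  by rewrite leNgt; apply/negP => /ltW/distribution_function_le; lra.
have [||x _ Fx] := @IVT _ F a b v ab; first exact: distribution_function_continuous.
  by rewrite ge_min le_max (ltW av) (ltW vb) orbT.
exists x => //; rewrite lt_neqAle f0 andbT; apply/eqP => /esym/distribution_function_eq0.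
by rewrite Fx => v00; rewrite v00 ltxx in v0.
Qed.

Definition quantile (v : R) : R :=
  if 0 < v < 1 then xget 0 [set x | 0 < f x /\ F x = v] else 0.

Lemma quantileP v : 0 < v < 1 -> 0 < f (quantile v) /\ F (quantile v) = v.
Proof.
move=> v01; rewrite /quantile v01; case: xgetP => [x _ //|].
by have [x fx Fx] := distribution_function_surj v01 => /(_ x)[].
Qed.

Lemma quantileK x : 0 < f x -> quantile (F x) = x.
Proof.
move=> fx; have Fx : 0 < F x < 1.
  by rewrite distribution_function_gt0// distribution_function_lt1.
have [fQ FQ] := quantileP Fx; apply/eqP; rewrite eq_le; apply/andP.
by split; rewrite leNgt; apply/negP => /distribution_function_lt;
  rewrite FQ ltxx => /(_ _)/notF; apply.
Qed.

Let quantile_galois v b : v \in `]0, 1[ -> (quantile v < b) = (v < F b).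
Proof.
rewrite in_itv => /= v01; have [fQ FQ] := quantileP v01.
apply/idP/idP => [Qb|].
  by rewrite -FQ distribution_function_lt// (f_up (ltW Qb)).
by apply: contraTT; rewrite -!leNgt -{2}FQ => /distribution_function_le.
Qed.

Lemma measurable_quantile : measurable_fun setT quantile.
Proof.
rewrite -(setUv `]0, 1[); apply/measurable_funU => //.
  by apply: measurableC; exact: measurable_itv.
split; first by apply: measurable_galois quantile_galois; exact: measurable_itv.
apply: (eq_measurable_fun (cst (0 : R))) => // v; rewrite inE/= in_itv/=.
by rewrite /quantile => /negP/negbTE ->.
Qed.

Lemma transports_quantile :
  transports lambda (\1_`]0, 1[ : R -> R)
    (quantile : measurableTypeR R -> measurableTypeR R) lambda f.
Proof.
apply: (@transports_galois _ _ _ F) => //.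
- exact: measurable_quantile.
- move=> b; rewrite distribution_functionEo.
  rewrite (_ : _ `&` _ = `]0, F b[%classic).
    rewrite lebesgue_measure_itv/= lte_fin sube0; case: ltP => // F0.
    by congr EFin; apply/eqP; rewrite eq_le F0 Rintegral_ge0.
  apply/seteqP; split => w /=; rewrite !in_itv/=.
    by move=> [/andP[-> _]].
  by move=> /andP[-> wF]; rewrite wF (lt_trans wF)// distribution_function_lt1.
- move=> b; apply: (@le_lt_trans _ _ (lambda `]0, 1[)).
    by apply: le_measure; rewrite ?inE//; apply: measurableI.
  by rewrite lebesgue_measure_itv/= lte_fin ltr01 ltry.
Qed.

End distribution_function.

(** * Powers and dilations *)

Section powers.
Context {R : realType}.
Local Notation lambda := (@lebesgue_measure R).
Variable t : R.
Hypothesis t0 : 0 < t.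

Lemma powRK (x : R) : 0 <= x -> (x `^ t) `^ t^-1 = x.
Proof. by move=> x0; rewrite -powRrM divff ?gt_eqF// powRr1. Qed.

Lemma powRVK (x : R) : 0 <= x -> (x `^ t^-1) `^ t = x.
Proof. by move=> x0; rewrite -powRrM mulVf ?gt_eqF// powRr1. Qed.

Lemma ltr_powRV (x y : R) : 0 <= x -> 0 <= y -> (x `^ t^-1 < y) = (x < y `^ t).
Proof.
move=> x0 y0; apply/idP/idP => [xy|].
  by rewrite -[ltLHS]powRVK// gt0_ltr_powR// ?nnegrE// powR_ge0.
by apply: contraTT; rewrite -!leNgt => /(ge0_ler_powR (ltW t0));
  rewrite powRVK// !nnegrE; apply => //; exact: powR_ge0.
Qed.

(** The derivative of [x ^ t] on the positive half-line, extended by 0. *)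
Definition power_density (x : R) : R := \1_`]0, +oo[%classic x * (t * x `^ (t - 1)).

Lemma power_density_ge0 x : 0 <= power_density x.
Proof. by rewrite !mulr_ge0// ?powR_ge0// ltW. Qed.

Lemma measurable_power_density : measurable_fun setT power_density.
Proof.
apply: measurable_funM; first exact: measurable_indic.
by apply: measurable_funM => //; exact: measurable_powR.
Qed.

Lemma integral_power_density_itvco a b : 0 < a -> a < b ->
  (\int[lambda]_(x in `[a, b[) (power_density x)%:E = (b `^ t - a `^ t)%:E)%E.
Proof.
move=> a0 ab; have b0 := lt_trans a0 ab.
have mE : measurable_fun `[a, b[ (EFin \o power_density).
  apply/measurable_EFinP; apply: measurable_funTS; exact: measurable_power_density.
rewrite integral_itv_bndo_bndc//.
rewrite (_ : (\int[_]_(x in _) _)%E =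
    \int[lambda]_(x in `[a, b]) (t * x `^ (t - 1))%:E)%E; last first.
  apply: eq_integral => x; rewrite inE/= in_itv/= => /andP[ax _].
  by rewrite /power_density indicE mem_set ?mul1r//= in_itv/= (lt_le_trans a0).
have dpow x : 0 < x -> derivable (@powR R ^~ t) x 1.
  by move=> x0; apply: ex_derive; exact: is_derive1_powR.
have cpow s x : 0 < x -> {for x, continuous (@powR R ^~ s)}.
  move=> x0; apply: differentiable_continuous; apply/derivable1_diffP.
  by apply: ex_derive; exact: is_derive1_powR.
rewrite (@continuous_FTC2 _ _ (@powR R ^~ t))//.
- apply: continuous_in_subspaceT => x; rewrite inE/= in_itv/= => /andP[ax _].
  apply: cvgM; first exact: cvg_cst.
  by apply: cpow; exact: lt_le_trans ax.
- split.
  + by move=> x; rewrite in_itv/= => /andP[ax _]; apply: dpow; exact: lt_trans ax.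
  + by apply: cvg_at_right_filter; exact: cpow.
  + by apply: cvg_at_left_filter; exact: cpow.
- move=> x; rewrite in_itv/= => /andP[ax _]; rewrite powR_derive1//.
  by rewrite in_itv/= andbT (lt_trans a0).
Qed.

(** For [t < 1] the density is unbounded near 0, so the fundamental theorem of
calculus is used away from 0 only, followed by monotone convergence. *)
Lemma integral_power_density_itvNyo b : 0 < b ->
  (\int[lambda]_(x in `]-oo, b[) (power_density x)%:E = (b `^ t)%:E)%E.
Proof.
move=> b0; have bt0 : 0 < b `^ t by exact: powR_gt0.
have mE A : measurable A -> measurable_fun A (EFin \o power_density).
  move=> mA; apply/measurable_EFinP; apply: measurable_funTS.
  exact: measurable_power_density.
(* the left endpoint is chosen so that its t-th power is b ^ t / (n + 2) *)
pose a n := (b `^ t / n.+2%:R) `^ t^-1.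
have a0 n : 0 < a n by rewrite powR_gt0// divr_gt0.
have atE n : a n `^ t = b `^ t / n.+2%:R by rewrite powRVK// ltW// divr_gt0.
have ab n : a n < b.
  rewrite /a ltr_powRV ?ltW// ?divr_gt0// ltr_pdivrMr// ltr_pMr//.
  by rewrite ltr1n.
have cvE : (\int[lambda]_(x in `[a n, b[) (power_density x)%:E @[n --> \oo] -->
    \int[lambda]_(x in \bigcup_n `[a n, b[%classic) (power_density x)%:E)%E.
  apply: ge0_nondecreasing_set_cvg_integral => //.
  - move=> m n mn; apply/subsetPset => x /=; rewrite !in_itv/= => /andP[amx ->].
    rewrite andbT (le_trans _ amx)// ge0_ler_powR ?nnegrE ?invr_ge0 ?divr_ge0 ?powR_ge0//.
      exact: ltW.
    by rewrite ler_pM2l// lef_pV2 ?posrE// ler_nat.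
  - by move=> n; exact: mE.
  - by move=> n x _; rewrite lee_fin power_density_ge0.
have UE : \bigcup_n `[a n, b[%classic = `]0, b[%classic.
  apply/seteqP; split=> x /=.
    by move=> [n _] /=; rewrite !in_itv/= => /andP[ax ->]; rewrite (lt_le_trans _ ax).
  rewrite in_itv/= => /andP[x0 xb].
  have xt0 : 0 < x `^ t by exact: powR_gt0.
  exists (Num.truncn (b `^ t / x `^ t)) => //=; rewrite in_itv/= xb andbT.
  rewrite leNgt; apply/negP => xa.
  have := gt0_ltr_powR t0 _ _ xa; rewrite !nnegrE atE => /(_ (ltW x0) (ltW (a0 _))).
  rewrite ltr_pdivlMr// mulrC -ltr_pdivlMr// => H.
  have := truncnS_gt (b `^ t / x `^ t); move/(lt_trans H).
  by rewrite ltr_nat ltnNge leqnSn.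
have : (\int[lambda]_(x in `[a n, b[) (power_density x)%:E @[n --> \oo] -->
    (b `^ t)%:E)%E.
  under eq_fun do rewrite integral_power_density_itvco// atE.
  apply: cvg_EFin; first by apply: nearW.
  rewrite -[X in _ --> X]subr0 -[X in _ - X](mulr0 (b `^ t)).
  apply: cvgB; first exact: cvg_cst.
  apply: cvgM; first exact: cvg_cst.
  by rewrite (cvg_shiftS (@harmonic R)); exact: cvg_harmonic.
move=> cvb; have := cvg_unique _ cvE cvb; rewrite UE => <- //.
rewrite integral_mkcond [RHS]integral_mkcond; apply: eq_integral => x _.
rewrite !patchE !mem_setE !in_itv/=.
have [_|_] := ltP x b; rewrite ?andbF ?andbT//; have [//|x0] := ltP 0 x.
by rewrite /power_density indicE memNset ?mul0r//= in_itv/= andbT ltNge x0.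
Qed.

(** The substitution [x = w ^ (1 / t)], under which Lebesgue measure on the
positive half-line becomes [t x ^ (t - 1) dx]. *)
Lemma transports_power :
  transports lambda (\1_`]0, +oo[ : R -> R)
    ((@powR R ^~ t^-1) : measurableTypeR R -> measurableTypeR R)
    lambda power_density.
Proof.
pose F b : R := Num.max 0 b `^ t.
have lF b : (lambda (`]0%R, +oo[ `&` `]-oo, F b[) = (F b)%:E)%E.
  rewrite (_ : _ `&` _ = `]0, F b[%classic); last first.
    by apply/seteqP; split=> x /=; rewrite !in_itv/= andbT => /andP.
  rewrite lebesgue_measure_itv/= lte_fin sube0; case: ltP => // F0.
  by congr EFin; apply/eqP; rewrite eq_le F0 powR_ge0.
apply: (@transports_galois _ _ _ F) => //.
- exact: measurable_power_density.
- exact: power_density_ge0.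
- move=> w b; rewrite /= in_itv/= andbT => w0; rewrite /F.
  have [b0|b0] := leP b 0; last by rewrite ltr_powRV// ltW.
  rewrite powR0 ?gt_eqF// [RHS]ltNge (ltW w0)/=; apply/negbTE.
  by rewrite -leNgt (le_trans b0)// powR_ge0.
- move=> b; rewrite lF /F; have [b0|b0] := leP b 0.
    rewrite powR0 ?gt_eqF// integral0_eq// => x; rewrite /= in_itv/= => xb.
    rewrite /power_density indicE memNset ?mul0r//= in_itv/= andbT ltNge.
    by rewrite (ltW (lt_le_trans xb b0)).
  by rewrite integral_power_density_itvNyo.
- by move=> b; rewrite lF ltry.
Qed.

End powers.

(** The intervals [(a, b]] have the right measure, and Lebesgue measure is the only
measure with these values. *)
Lemma transports_dilation (R : realType) (r : R) : 0 < r ->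
  transports (@lebesgue_measure R) (cst r)
    (( *%R r) : measurableTypeR R -> measurableTypeR R)
    (@lebesgue_measure R) (cst 1).
Proof.
move=> r0; have mr : measurable_fun setT ( *%R r : R -> R) by exact: measurable_funM.
apply: transports_indic => //; first by move=> x /=; exact: ltW.
have [m mE] := exists_pushforward_density (@lebesgue_measure R) (Y := measurableTypeR R)
  (@measurable_cst _ _ _ _ setT r) (fun=> ltW r0) mr.
move=> A mA; rewrite -mE integral_cst_EFin// mul1e; apply/esym.
apply: lebesgue_measure_unique => // _ [[a b] _ <-]/=; rewrite mE.
rewrite (_ : _ @^-1` _ = `]r^-1 * a, r^-1 * b]%classic); last first.
  by apply/seteqP; split=> x; rewrite /= !in_itv/= ltr_pdivrMl// ler_pdivlMl.
rewrite integral_cst_EFin// /= !lebesgue_measure_itv/= !lte_fin ltr_pM2l ?invr_gt0//.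
case: ifP => _; last by rewrite mule0.
by rewrite -!EFinB -EFinM mulrBr !mulrA divff ?gt_eqF// !mul1r.
Qed.

(** * Polar coordinates *)

Section polar_maps.
Context {R : realType} {d : nat}.
Implicit Types x : d.-tuple R.

Definition scale (r : R) x : d.-tuple R := map_tuple ( *%R r) x.

(** As [0^-1 = 0], the direction of the null vector is the null vector, so that
[scale_enorm_direction] has no exception. *)
Definition direction x : d.-tuple R := scale (enorm x)^-1 x.

Lemma tnth_scale r x i : tnth (scale r x) i = r * tnth x i.
Proof. by rewrite tnth_map. Qed.

Lemma scale_scale r s x : scale r (scale s x) = scale (r * s) x.
Proof. by apply: eq_from_tnth => i; rewrite !tnth_scale mulrA. Qed.

Lemma scale1 x : scale 1 x = x.
Proof. by apply: eq_from_tnth => i; rewrite tnth_scale mul1r. Qed.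

Lemma enorm_ge0 x : 0 <= enorm x. Proof. exact: sqrtr_ge0. Qed.

Lemma sqr_enorm x : enorm x ^+ 2 = \sum_(i < d) tnth x i ^+ 2.
Proof. by rewrite sqr_sqrtr// sumr_ge0// => i _; rewrite sqr_ge0. Qed.

Lemma enorm_eq0 x : enorm x = 0 -> x = [tuple 0 | i < d].
Proof.
move=> x0; have : \sum_(i < d) tnth x i ^+ 2 = 0 by rewrite -sqr_enorm x0 expr0n.
move/eqP; rewrite psumr_eq0 => [/allP /= H|i _]; last exact: sqr_ge0.
apply: eq_from_tnth => i; rewrite tnth_mktuple; apply/eqP.
by have := H i (mem_index_enum _); rewrite sqrf_eq0.
Qed.

Lemma enorm0 : enorm [tuple (0 : R) | i < d] = 0.
Proof. by rewrite /enorm big1 ?sqrtr0// => i _; rewrite tnth_mktuple expr0n. Qed.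

Lemma enorm_scale r x : 0 <= r -> enorm (scale r x) = r * enorm x.
Proof.
move=> r0; rewrite /enorm (_ : \sum_(i < d) _ = r ^+ 2 * \sum_(i < d) tnth x i ^+ 2).
  by rewrite sqrtrM ?sqr_ge0// sqrtr_sqr ger0_norm.
by rewrite mulr_sumr; apply: eq_bigr => i _; rewrite tnth_scale exprMn.
Qed.

Lemma scale_enorm_direction x : scale (enorm x) (direction x) = x.
Proof.
rewrite /direction scale_scale; have [x0|x0] := eqVneq (enorm x) 0.
  apply: eq_from_tnth => i.
  by rewrite tnth_scale x0 !mul0r (enorm_eq0 x0) tnth_mktuple.
by rewrite divff// scale1.
Qed.

Lemma enorm_direction x : enorm x != 0 -> enorm (direction x) = 1.
Proof.
by move=> x0; rewrite enorm_scale ?invr_ge0 ?enorm_ge0// mulVf.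
Qed.

Lemma direction_scale r x : 0 < r -> direction (scale r x) = direction x.
Proof.
move=> r0; rewrite /direction scale_scale enorm_scale ?ltW//.
by rewrite invfM mulrAC mulVf ?gt_eqF// mul1r.
Qed.

Lemma direction_eq0 x : enorm x = 0 -> direction x = x.
Proof.
move=> x0; rewrite (enorm_eq0 x0); apply: eq_from_tnth => i.
by rewrite tnth_scale !tnth_mktuple mulr0.
Qed.

Lemma scale_eq0 r x : enorm x = 0 -> scale r x = x.
Proof.
move=> x0; rewrite (enorm_eq0 x0); apply: eq_from_tnth => i.
by rewrite tnth_scale !tnth_mktuple mulr0.
Qed.

Lemma enorm_gt0 x : enorm x != 0 -> 0 < enorm x.
Proof. by move=> x0; rewrite lt_def x0 enorm_ge0. Qed.

Lemma direction_scale_direction r x : 0 < r -> enorm x != 0 ->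
  direction (scale r (direction x)) = direction x.
Proof.
move=> r0 x0; rewrite direction_scale// {2}/direction direction_scale//.
by rewrite invr_gt0 enorm_gt0.
Qed.

Lemma enorm_scale_direction r x : 0 <= r -> enorm x != 0 ->
  enorm (scale r (direction x)) = r.
Proof. by move=> r0 x0; rewrite enorm_scale// enorm_direction// mulr1. Qed.

Lemma measurable_enorm : measurable_fun setT (@enorm R d).
Proof.
apply: measurableT_comp.
  by apply: continuous_measurable_fun; exact: sqrt_continuous.
apply: measurable_sum => i.
by apply: measurable_funX; exact: measurable_tnth.
Qed.

Lemma measurable_scale : measurable_fun setT
  (fun z : measurableTypeR R * d.-tuple R => scale z.1 z.2).
Proof.
apply/measurable_fun_tnthP => i.
rewrite (_ : _ \o _ =
    fun z : measurableTypeR R * d.-tuple R => z.1 * tnth z.2 i).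
  apply: measurable_funM; first exact: measurable_fst.
  exact: measurableT_comp (measurable_tnth i) measurable_snd.
by apply/funext => z /=; rewrite tnth_scale.
Qed.

Lemma measurable_direction : measurable_fun setT direction.
Proof.
have H : measurable_fun setT
    (fun x : d.-tuple R => ((enorm x)^-1 : measurableTypeR R, x)).
  apply: measurable_fun_pair => //.
  under eq_fun do rewrite -powR_inv1 ?enorm_ge0//.
  exact: measurableT_comp (measurable_powR _) measurable_enorm.
exact: (measurableT_comp measurable_scale H).
Qed.

End polar_maps.

Section polar.
Context {R : realType}.
Variable d : nat.
Hypothesis d0 : (0 < d)%N.
Local Notation lambda := (@lebesgue_measure R).
Local Notation lambdad := (@lebesgue_tuple R d).

Lemma measurable_unit_ball : measurable (@unit_ball R d).
Proof.
rewrite (_ : @unit_ball R d = @enorm R d @^-1` `]-oo, 1[%classic).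
  by rewrite -[X in measurable X]setTI; exact: measurable_enorm.
by apply/seteqP; split=> x; rewrite /unit_ball /= in_itv.
Qed.

Lemma unit_ball_lty : (lambdad (@unit_ball R d) < +oo)%E.
Proof.
apply: (@le_lt_trans _ _ (lambdad [set x | forall i, `[-1, 1]%classic (tnth x i)])).
  apply: le_measure; rewrite ?inE.
  - exact: measurable_unit_ball.
  - rewrite (_ : [set _ | _] = \bigcap_(i in [set: 'I_d])
        ((fun x => tnth x i) @^-1` `[-1, 1]%classic)).
      apply: fin_bigcap_measurable => // i _.
      by rewrite -[X in measurable X]setTI; exact: measurable_tnth.
    by apply/seteqP; split=> x /= xA i => [_|]; exact: xA.
  - move=> x /= xB i; rewrite /= in_itv/= -ler_norml.
    rewrite -[leLHS]sqrtr_sqr (le_trans _ (ltW xB))// ler_wsqrtr//.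
    by rewrite (bigD1 i)//= lerDl sumr_ge0// => j _; exact: sqr_ge0.
rewrite (@lebesgue_tuple_box R d (fun=> `[-1, 1]%classic))//.
under eq_bigr do rewrite lebesgue_measure_itv/= lte_fin gtrN// -EFinB.
by rewrite prodEFin ltry.
Qed.

(** [sigma] plays the role of the surface measure of the sphere divided by [d]; it
is a measure on the ambient space which, for [d > 0], is concentrated on the unit
sphere. *)
Lemma exists_sphere_measure : exists sigma : {finite_measure set (d.-tuple R) -> \bar R},
  forall E, measurable E -> sigma E = lambdad (@unit_ball R d `&` direction @^-1` E).
Proof.
have mB := measurable_unit_ball.
have indic_ge0 x : 0 <= \1_(@unit_ball R d) x :> R by rewrite indicE ler0n.
have [m mE] := exists_pushforward_density lambdad (measurable_indic (D := setT) mB)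
  indic_ge0 (@measurable_direction R d).
have fm : fin_num_fun m.
  move=> E mE'; rewrite mE integral_indic//; last first.
    by rewrite -[X in measurable X]setTI; exact: measurable_direction.
  rewrite ge0_fin_numE//; apply: le_lt_trans unit_ball_lty.
  apply: le_measure; rewrite ?inE//; apply: measurableI => //.
  by rewrite -[X in measurable X]setTI; exact: measurable_direction.
pose m0 A := m A.
pose M1 := isMeasure.Build _ _ _ m0 (measure0 m) (measure_ge0 m)
  (@measure_semi_sigma_additive _ _ _ m).
pose mm : {measure set (d.-tuple R) -> \bar R} := HB.pack m0 M1.
pose M2 := Measure_isFinite.Build _ _ _ mm fm.
pose s : {finite_measure set (d.-tuple R) -> \bar R} := HB.pack m0 M1 M2.
exists s => E mE'; rewrite /s/= /m0 mE integral_indic//.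
by rewrite -[X in measurable X]setTI; exact: measurable_direction.
Qed.

Local Open Scope ereal_scope.

Lemma measurable_enormX : measurable_fun setT (fun x : d.-tuple R => enorm x ^+ d)%R.
Proof. by apply: measurable_funX; exact: measurable_enorm. Qed.

(** The sector is the image of the corresponding sector of the unit ball under the
dilation of ratio [b ^ (1 / d)], which multiplies Lebesgue measure by [b]. *)
Lemma lebesgue_tuple_sector (sigma : {finite_measure set (d.-tuple R) -> \bar R})
    (E : set (d.-tuple R)) (b : R) :
  (forall E, measurable E ->
    sigma E = lambdad (@unit_ball R d `&` direction @^-1` E)) ->
  measurable E -> (0 < b)%R ->
  lambdad ([set x | (enorm x ^+ d < b)%R] `&` direction @^-1` E) = b%:E * sigma E.
Proof.
move=> sigmaE mE b0; rewrite sigmaE//.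
have mdE : measurable (direction @^-1` E).
  by rewrite -[X in measurable X]setTI; exact: measurable_direction.
have mb : measurable [set x : d.-tuple R | (enorm x ^+ d < b)%R].
  rewrite (_ : [set _ | _] = (fun x => enorm x ^+ d)%R @^-1` `]-oo, b[%classic).
    by rewrite -[X in measurable X]setTI; exact: measurable_enormX.
  by apply/seteqP; split=> x /=; rewrite in_itv.
set A := _ `&` _; have mA : measurable A by exact: measurableI.
pose r := (b `^ d%:R^-1)%R.
have r0 : (0 < r)%R by exact: powR_gt0.
have rd : (r ^+ d = b)%R.
  by rewrite -powR_mulrn ?ltW// powRVK ?ltr0n// ltW.
have mB := @measurable_unit_ball.
have dil : transports lambdad (fun x => \prod_(i < d) r)%R (scale r)
    lambdad (fun y => \prod_(i < d) 1)%R.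
  apply: (transports_tuple (k := cst r) (h := cst 1%R)) => //.
  - by move=> x; exact: ltW.
  - exact: transports_dilation.
have dilA : forall x, \1_A (scale r x) = \1_(@unit_ball R d `&` direction @^-1` E) x :> R.
  move=> x; rewrite !indicE; congr (_%:R); congr nat_of_bool.
  apply/idP/idP; rewrite !inE /A /=;
  rewrite direction_scale// enorm_scale ?(ltW r0)// exprMn rd => -[H ?];
  split => //; move: H.
    rewrite gtr_pMr// /unit_ball/= => H; rewrite ltNge; apply/negP => H'.
    by move: H; rewrite ltNge exprn_ege1.
  by rewrite gtr_pMr// => H; rewrite exprn_ilt1// ?enorm_ge0// -lt0n.
transitivity (\int[lambdad]_y (\1_A y)%:E); first by rewrite integral_indic ?setIT.
transitivity (\int[lambdad]_y ((\1_A y)%:E * (\prod_(i < d) (1 : R))%R%:E)).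
  by apply: eq_integral => y _; rewrite big1// mule1.
rewrite -(dil (EFin \o \1_A)); last 2 first.
- by apply/measurable_EFinP; exact: measurable_indic.
- by move=> y; rewrite lee_fin indicE.
transitivity (\int[lambdad]_x (b%:E * (\1_(@unit_ball R d `&` direction @^-1` E) x)%:E)).
  by apply: eq_integral => x _; rewrite muleC prodr_const card_ord rd /= dilA.
rewrite ge0_integralZl//.
- by rewrite integral_indic ?setIT//; apply: measurableI.
- by apply/measurable_EFinP; apply: measurable_indic; apply: measurableI.
- by rewrite lee_fin ltW.
Qed.

End polar.

Section polar_coordinates.
Context {R : realType}.
Local Open Scope ereal_scope.
Variable d : nat.
Hypothesis d0 : (0 < d)%N.
Local Notation lambda := (@lebesgue_measure R).
Local Notation lambdad := (@lebesgue_tuple R d).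
Local Notation itv0y := (`]0%R, +oo[%classic : set R).

(** Product measures are determined by their values on rectangles when the factors
are sigma-finite, hence the need for sigma-finiteness of the restriction. *)
Lemma exists_half_line_measure :
  exists m : {sigma_finite_measure set (measurableTypeR R) -> \bar R},
    forall A, measurable A -> m A = lambda (itv0y `&` A).
Proof.
have [m mE] := exists_pushforward_density lambda (Y := measurableTypeR R)
  (measurable_indic (D := setT) (measurable_itv `]0%R, +oo[))
  (fun x => ler0n _ _) (@measurable_id _ _ setT).
have {}mE A : measurable A -> m A = lambda (itv0y `&` A).
  by move=> mA; rewrite mE integral_indic.
have sf : sigma_finite setT m.
  have [F FT Foo] := sigma_finiteT lambda.
  exists F => // i; have [mF Fi] := Foo i; split => //.
  rewrite mE//; apply: le_lt_trans Fi.
  by apply: le_measure; rewrite ?inE//; apply: measurableI.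
pose m0 A := m A.
pose M1 := isMeasure.Build _ _ _ m0 (measure0 m) (measure_ge0 m)
  (@measure_semi_sigma_additive _ _ _ m).
pose mm : {measure set (measurableTypeR R) -> \bar R} := HB.pack m0 M1.
pose M2 := Measure_isSigmaFinite.Build _ _ _ mm sf.
pose s : {sigma_finite_measure set (measurableTypeR R) -> \bar R} :=
  HB.pack m0 M1 M2.
by exists s.
Qed.

Definition polar_map (x : d.-tuple R) : measurableTypeR R * d.-tuple R :=
  (enorm x ^+ d, direction x)%R.

Lemma measurable_polar_map : measurable_fun setT polar_map.
Proof.
apply: measurable_fun_pair; first exact: measurable_enormX.
exact: measurable_direction.
Qed.

Variable sigma : {finite_measure set (d.-tuple R) -> \bar R}.
Hypothesis sigmaE : forall E, measurable E ->
  sigma E = lambdad (@unit_ball R d `&` direction @^-1` E).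

(** For a fixed set of directions both sides are measures in the radial variable,
which agree on lower half-lines by [lebesgue_tuple_sector]. *)
Lemma transports_enormX E : measurable E ->
  transports lambdad (\1_(direction @^-1` E) : d.-tuple R -> R)
    ((fun x => enorm x ^+ d)%R : d.-tuple R -> measurableTypeR R)
    lambda (fun w => fine (sigma E) * \1_itv0y w)%R.
Proof.
move=> mE.
have mdE : measurable (direction @^-1` E).
  by rewrite -[X in measurable X]setTI; exact: measurable_direction.
have sE : (fine (sigma E))%:E = sigma E by rewrite fineK// fin_num_measure.
have s0 : (0 <= fine (sigma E))%R by exact: fine_ge0.
have intE b : \int[lambda]_(w in `]-oo, b[)
    (fine (sigma E) * \1_itv0y w)%:E = sigma E * lambda (itv0y `&` `]-oo, b[).
  under eq_integral do rewrite EFinM.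
  rewrite ge0_integralZl//; first by rewrite sE integral_indic.
  by apply/measurable_EFinP; exact: measurable_indic.
have interE b : itv0y `&` `]-oo, b[ = `]0%R, b[%classic.
  by apply/seteqP; split=> x /=; rewrite !in_itv/= andbT => /andP.
apply: transports_itvNyo.
- exact: measurable_indic.
- by move=> x; rewrite indicE ler0n.
- by apply: measurable_funM => //; exact: measurable_indic.
- by move=> w; rewrite mulr_ge0// indicE ler0n.
- exact: measurable_enormX.
- move=> b; rewrite intE interE lebesgue_measure_itv/= lte_fin sube0.
  rewrite integral_indic//; last first.
    rewrite (_ : [set _ | _] = (fun x => enorm x ^+ d)%R @^-1` `]-oo, b[%classic).
      by rewrite -[X in measurable X]setTI; exact: measurable_enormX.
    by apply/seteqP; split=> x /=; rewrite in_itv.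
  rewrite setIC; case: ltP => [b0|b0].
    by rewrite muleC; exact: lebesgue_tuple_sector.
  rewrite (_ : _ `&` _ = set0) ?measure0 ?mule0//.
  apply/seteqP; split => // x /= [xb _]; move: xb.
  by rewrite ltNge (le_trans b0)// exprn_ge0// enorm_ge0.
- move=> b; rewrite intE interE lebesgue_measure_itv/= lte_fin sube0 -sE.
  by case: ifP => _; rewrite ?mule0 -?EFinM ltry.
Qed.

(** The map to (norm ^ d, direction) sends Lebesgue measure to a measure with the
right values on rectangles, hence to the product measure. *)
Lemma integral_polar (g : measurableTypeR R * d.-tuple R -> \bar R) :
  measurable_fun setT g -> (forall z, 0 <= g z) ->
  \int[lambdad]_x g (enorm x ^+ d, direction x)%R =
  \int[sigma]_e \int[lambda]_w (g (w, e) * (\1_itv0y w)%:E).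
Proof.
move=> mg g0; have [m1 m1E] := exists_half_line_measure.
have tr1 : transports m1 (cst 1%R)
    (idfun : measurableTypeR R -> measurableTypeR R) lambda (\1_itv0y : R -> R).
  apply: transports_indic => //; first exact: measurable_id.
  move=> A mA; transitivity (m1 A); last by rewrite m1E// integral_indic.
  by rewrite -[RHS]mul1e; exact: integral_cst_EFin.
have tr2 : transports lambdad (cst 1%R) polar_map (m1 \x sigma) (cst 1%R).
  have [m mE] := exists_pushforward_density lambdad
    (@measurable_cst _ _ _ _ setT (1 : R)%R) (fun=> ler01) measurable_polar_map.
  apply: transports_indic => //; first exact: measurable_polar_map.
  move=> Z mZ; rewrite -mE; transitivity ((m1 \x sigma) Z); last first.
    by rewrite -[LHS]mul1e; apply/esym; exact: integral_cst_EFin.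
  apply/esym.
  apply: product_measure_unique => // C E mC mE'.
  have mC' : measurable_fun setT (EFin \o \1_C : measurableTypeR R -> \bar R).
    by apply/measurable_EFinP; exact: measurable_indic.
  have C0 w : 0 <= (EFin \o (\1_C : _ -> R)) w by rewrite lee_fin indicE ler0n.
  have := transports_enormX mE' mC' C0.
  have mT : measurable (polar_map @^-1` (C `*` E)).
    rewrite -[X in measurable X]setTI; apply: measurable_polar_map => //.
    exact: measurableX.
  have -> : m (C `*` E) = \int[lambdad]_x ((EFin \o \1_C) (enorm x ^+ d)%R *
      (\1_(direction @^-1` E) x)%:E).
    rewrite mE integral_cst_EFin// mul1e -[in LHS](setIT (_ @^-1` _)).
    rewrite -integral_indic//; apply: eq_integral => x _.
    rewrite /= -EFinM !indicE -natrM mulnb; congr (_%:R%:E); congr nat_of_bool.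
    by apply/idP/andP; rewrite !inE.
  move=> ->.
  transitivity (\int[lambda]_y ((fine (sigma E))%:E * (\1_(itv0y `&` C) y)%:E)).
    apply: eq_integral => y _; rewrite /= indicI EFinM/= muleCA.
    by rewrite -EFinM [(_ * \1_C y)%R]mulrC.
  rewrite ge0_integralZl//.
  - by rewrite integral_indic ?setIT ?m1E// 1?muleC ?fineK// ?fin_num_measure//;
      exact: measurableI.
  - by apply/measurable_EFinP; apply: measurable_indic; apply: measurableI.
  - by rewrite lee_fin fine_ge0.
have := tr2 g mg g0.
under eq_integral do rewrite mule1.
under [RHS]eq_integral do rewrite mule1.
move=> ->; rewrite fubini_tonelli2//; apply: eq_integral => e _.
rewrite /fubini_G -(tr1 (fun w => g (w, e)))//.
  by apply: eq_integral => w _; rewrite mule1.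
by apply: measurableT_comp => //; exact: measurable_pair2.
Qed.

End polar_coordinates.

(** * The Gaussian density and the error function *)

Section gauss_density.
Context {R : realType}.
Local Notation lambda := (@lebesgue_measure R).

Definition gauss_density (x : R) : R := expR (- x ^+ 2) / Num.sqrt pi.

Let sqrtpi_gt0 : 0 < Num.sqrt (pi : R).
Proof. by rewrite sqrtr_gt0 pi_gt0. Qed.

Lemma gauss_density_gt0 x : 0 < gauss_density x.
Proof. by rewrite divr_gt0// expR_gt0. Qed.

Lemma gauss_density_ge0 x : 0 <= gauss_density x.
Proof. exact: ltW (gauss_density_gt0 x). Qed.

Lemma measurable_gauss_density : measurable_fun setT gauss_density.
Proof. by apply: measurable_funM => //; exact: measurable_gauss_fun. Qed.

Lemma integral_gauss_density : (\int[lambda]_x (gauss_density x)%:E = 1)%E.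
Proof.
under eq_integral do rewrite EFinM.
rewrite ge0_integralZr//.
- rewrite (_ : (\int[_]_(_ in _) _)%E = (Num.sqrt pi)%:E)%E; last exact: integralT_gauss.
  by rewrite -EFinM divff// gt_eqF.
- by apply/measurable_EFinP; exact: measurable_gauss_fun.
Qed.

Lemma ray_density_gauss : ray_density gauss_density.
Proof.
split.
- exact: measurable_gauss_density.
- exact: gauss_density_ge0.
- exact: integral_gauss_density.
- by move=> x y _ _; exact: gauss_density_gt0.
- move=> x _; exists (x - 1); last exact: gauss_density_gt0.
  by rewrite gtrDl oppr_lt0.
Qed.

Local Notation F := (distribution_function gauss_density).

Let integrable_gauss (A : set R) : measurable A ->
  lambda.-integrable A (EFin \o gauss_density).
Proof. by move=> mA; apply: integrableS (integrable_density ray_density_gauss). Qed.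

Lemma distribution_function_gauss0 : F 0 = 2^-1.
Proof.
have H1 : F 0 + \int[lambda]_(t in `]0, +oo[) gauss_density t = 1.
  have := @Rintegral_itvB _ gauss_density -oo%O +oo%O 0 (integrable_gauss _) isT isT.
  rewrite set_itvNyy -[X in X - _]/(fine _) integral_gauss_density/= => <-//.
  by rewrite addrC subrK.
suff : \int[lambda]_(t in `]0, +oo[) gauss_density t = 2^-1 by lra.
rewrite /gauss_density RintegralZr//; last first.
  by apply: integrableS integrableT_gauss.
rewrite Rintegral_itv_obnd_cbnd; last by apply: integrableS integrableT_gauss.
rewrite /Rintegral integral0y_gauss/= mulrAC divff ?gt_eqF//.
by rewrite mul1r.
Qed.

Lemma erfE (x : R) : erf x = 2 * F x - 1.
Proof.
have F0 := distribution_function_gauss0.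
have Z (A : set R) : measurable A -> \int[lambda]_(t in A) gauss_density t =
    (\int[lambda]_(t in A) expR (- t ^+ 2)) / Num.sqrt pi.
  move=> mA; rewrite /gauss_density RintegralZr//.
  by apply: integrableS integrableT_gauss.
have FB := distribution_functionB ray_density_gauss.
have oc a b : \int[lambda]_(t in `[a, b]) expR (- t ^+ 2) =
    \int[lambda]_(t in `]a, b]) expR (- t ^+ 2) :> R.
  by rewrite Rintegral_itv_obnd_cbnd//; apply: integrableS integrableT_gauss.
rewrite /erf; case: ifPn => [x0|]; rewrite oc.
  have := FB _ _ x0; rewrite Z// F0; set I := Rintegral _ _ _ => H.
  by rewrite mulrAC -mulrA -H; lra.
rewrite -ltNge => /ltW x0.
have := FB _ _ x0; rewrite Z// F0; set I := Rintegral _ _ _ => H.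
by rewrite mulrN mulrAC -mulrA -H; lra.
Qed.

(** [erf] is injective and takes the value [2 v - 1] at the quantile of [v], which
therefore is the value of the inverse picked by [erfinv]. *)
Lemma erfinv_quantile (v : R) : 0 < v < 1 ->
  erfinv (2 * v - 1) = quantile gauss_density v.
Proof.
move=> v01; have [_ FQ] := quantileP ray_density_gauss v01.
rewrite -[in LHS]FQ -erfE /erfinv; apply: pinvKV; last by rewrite inE.
move=> x y _ _; rewrite !erfE => xy.
rewrite -(quantileK ray_density_gauss (gauss_density_gt0 x)).
rewrite -(quantileK ray_density_gauss (gauss_density_gt0 y)).
by congr (quantile _ _); lra.
Qed.

End gauss_density.

(** * From the cube to the Gaussian law *)

Section gauss_tuple.
Context {R : realType}.
Variable d : nat.
Local Notation lambdad := (@lebesgue_tuple R d).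

Lemma measurable_unit_cube : measurable (@unit_cube R d).
Proof.
rewrite (_ : @unit_cube R d = \bigcap_(i in [set: 'I_d])
    ((fun x => tnth x i) @^-1` `]0, 1[%classic)).
  apply: fin_bigcap_measurable => // i _.
  by rewrite -[X in measurable X]setTI; exact: measurable_tnth.
by apply/seteqP; split=> x /= xA i => [_|]; have := xA i; rewrite /= in_itv/=//; apply.
Qed.

Lemma lebesgue_unit_cube : (lambdad (@unit_cube R d) = 1)%E.
Proof.
rewrite (_ : @unit_cube R d = [set x | forall i, `]0, 1[%classic (tnth x i)]).
  rewrite (@lebesgue_tuple_box R d (fun=> `]0, 1[%classic))//.
  by rewrite big1// => i _; rewrite lebesgue_measure_itv/= lte_fin ltr01 sube0.
by apply/seteqP; split=> x /= xA i; have := xA i; rewrite /= in_itv.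
Qed.

Definition gauss_const : R := (Num.sqrt pi)^-1 ^+ d.

Lemma gauss_const_gt0 : 0 < gauss_const.
Proof. by rewrite exprn_gt0// invr_gt0 sqrtr_gt0 pi_gt0. Qed.

Lemma integral_cube_gauss (g : d.-tuple R -> \bar R) :
  measurable_fun setT g -> (forall y, 0 <= g y)%E ->
  (\int[lambdad]_(x in @unit_cube R d) g (map_tuple (quantile gauss_density) x) =
   \int[lambdad]_y (g y * (gauss_const * expR (- enorm y ^+ 2))%:E))%E.
Proof.
move=> mg g0; have gP := @ray_density_gauss R.
have [mgd gd0 _ _ _] := gP.
have ind0 x : 0 <= (\1_`]0%R, 1%R[%classic : R -> R) x by rewrite indicE ler0n.
have m01 : measurable_fun setT (\1_`]0%R, 1%R[%classic : R -> R).
  by apply: measurable_indic; exact: measurable_itv.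
have H := @transports_tuple R d _ _ _ m01 ind0 mgd gd0 (measurable_quantile gP)
  (transports_quantile gP) g mg g0.
rewrite integral_mkcond.
transitivity (\int[lambdad]_x (g (map_tuple (quantile gauss_density) x) *
    (\prod_(i < d) \1_`]0%R, 1%R[%classic (tnth x i))%:E))%E.
  apply: eq_integral => x _; rewrite patchE.
  have [|/negP xU] := boolP (x \in @unit_cube R d).
    rewrite inE => xU; rewrite big1 ?mule1// => i _.
    by rewrite indicE mem_set//= in_itv/=; exact: xU.
  have [i /negP xi] : exists i, ~ (0 < tnth x i < 1).
    by apply/existsNP => H'; apply: xU; rewrite inE.
  rewrite (bigD1 i)//= indicE memNset ?mul0r ?mule0//=.
  by rewrite in_itv/=; exact/negP.
rewrite {}H.
apply: eq_integral => y _; congr (_ * _%:E)%E.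
rewrite big_split/= prodr_const card_ord mulrC; congr (_ * _).
by rewrite -expR_sum sumrN sqr_enorm.
Qed.

End gauss_tuple.

(** * The radial part of the Gaussian law *)

Section gamma_fun.
Context {R : realType}.
Local Open Scope ereal_scope.
Local Notation lambda := (@lebesgue_measure R).
Local Notation itv0y := (`]0%R, +oo[%classic : set R).
Variable t : R.

Definition gamma_fun (u : R) : R :=
  (\1_itv0y u * (u `^ (t - 1) * expR (- u)))%R.

Lemma gamma_fun_ge0 u : (0 <= gamma_fun u)%R.
Proof. by rewrite !mulr_ge0// ?powR_ge0 ?expR_ge0. Qed.

Lemma measurable_gamma_fun : measurable_fun setT gamma_fun.
Proof.
apply: measurable_funM; first exact: measurable_indic.
apply: measurable_funM; first exact: measurable_powR.
by apply: measurableT_comp => //; exact: measurableT_comp.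
Qed.

Lemma integral_gamma_fun_itv (A : set R) : measurable A ->
  \int[lambda]_(u in A) (gamma_fun u)%:E =
  \int[lambda]_(u in itv0y `&` A) (u `^ (t - 1) * expR (- u))%:E.
Proof.
move=> mA; rewrite integral_mkcondl; apply: eq_integral => u _.
by rewrite epatch_indic muleC -EFinM.
Qed.

Lemma integral_gamma_fun b : \int[lambda]_(u in `]-oo, b]) (gamma_fun u)%:E =
  \int[lambda]_(u in `]0%R, b]) (u `^ (t - 1) * expR (- u))%:E.
Proof.
rewrite integral_gamma_fun_itv// (_ : _ `&` _ = `]0%R, b]%classic)//.
by apply/seteqP; split=> x /=; rewrite !in_itv/= andbT => /andP.
Qed.

End gamma_fun.

Section radial_integral.
Context {R : realType}.
Local Open Scope ereal_scope.
Variable d : nat.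
Hypothesis d0 : (0 < d)%N.
Local Notation lambda := (@lebesgue_measure R).
Local Notation lambdad := (@lebesgue_tuple R d).
Local Notation itv0y := (`]0%R, +oo[%classic : set R).
Local Notation t := (d%:R / 2 : R)%R.

Let t0 : (0 < t)%R. Proof. by rewrite divr_gt0// ltr0n. Qed.

Variable sigma : {finite_measure set (d.-tuple R) -> \bar R}.
Hypothesis sigmaE : forall E, measurable E ->
  sigma E = lambdad (@unit_ball R d `&` direction @^-1` E).

(** The substitution [w = u ^ (d / 2)] in [integral_polar], which replaces
[||y|| ^ d] by the variable [||y|| ^ 2] of the Gaussian density. *)
Lemma integral_radial (g : measurableTypeR R * d.-tuple R -> \bar R) :
  measurable_fun setT g -> (forall z, 0 <= g z) ->
  \int[lambdad]_y g (enorm y ^+ 2, direction y)%R =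
  \int[sigma]_e \int[lambda]_u (g (u, e) * (power_density t u)%:E).
Proof.
move=> mg g0.
pose g' (z : measurableTypeR R * d.-tuple R) := g (z.1 `^ t^-1, z.2)%R.
have mg' : measurable_fun setT g'.
  apply: measurableT_comp => //; apply: measurable_fun_pair => //.
  exact: measurableT_comp (measurable_powR _) measurable_fst.
transitivity (\int[lambdad]_y g' (enorm y ^+ d, direction y)%R).
  apply: eq_integral => y _; congr (g (_, _)).
  rewrite /= -!powR_mulrn ?enorm_ge0// -powRrM invf_div; congr (_ `^ _)%R.
  by rewrite mulrCA divff ?mulr1// pnatr_eq0 -lt0n.
rewrite (integral_polar d0 sigmaE mg' (fun z => g0 _)).
apply: eq_integral => e _.
rewrite -(transports_power t0 (g := fun u => g (u, e)))//.
by apply: measurableT_comp => //; exact: measurable_pair2.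
Qed.

Let densityM u : (expR (- u) * power_density t u = t * gamma_fun t u)%R.
Proof. by rewrite /power_density /gamma_fun; ring. Qed.

(** The integral of the Gaussian density is computed once through the cube and once
in polar coordinates.  The product is taken in the extended reals: the finiteness
of the last factor is a consequence, not an assumption. *)
Lemma gauss_const_Gamma :
  sigma setT * ((@gauss_const R d * t)%:E * \int[lambda]_u (gamma_fun t u)%:E) = 1.
Proof.
transitivity (lambdad (@unit_cube R d)); last exact: lebesgue_unit_cube.
transitivity (\int[lambdad]_(x in @unit_cube R d) (cst 1%R x)%:E); last first.
  by rewrite integral_cst_EFin ?mul1e//; exact: measurable_unit_cube.
rewrite (integral_cube_gauss (g := cst 1))//.
pose g (z : measurableTypeR R * d.-tuple R) := (@gauss_const R d * expR (- z.1))%:E.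
have mg : measurable_fun setT g.
  apply/measurable_EFinP; apply: measurable_funM => //.
  by apply: measurableT_comp => //; apply: measurableT_comp => //; exact: measurable_fst.
have g0 z : 0 <= g z.
  by rewrite lee_fin mulr_ge0 ?expR_ge0// ltW// gauss_const_gt0.
transitivity (\int[lambdad]_y g (enorm y ^+ 2, direction y)%R); last first.
  by apply: eq_integral => y _; rewrite mul1e.
rewrite (integral_radial mg g0).
transitivity (\int[sigma]_e (cst ((@gauss_const R d * t)%:E *
    \int[lambda]_u (gamma_fun t u)%:E) e)).
  by rewrite integral_cst// muleC.
apply: eq_integral => e _; rewrite /cst -ge0_integralZl//.
- apply: eq_integral => u _; rewrite /g/= -!EFinM; congr EFin.
  by rewrite -mulrA -densityM mulrA.
- by apply/measurable_EFinP; exact: measurable_gamma_fun.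
- by move=> u _; rewrite lee_fin gamma_fun_ge0.
- by rewrite lee_fin mulr_ge0// ltW// gauss_const_gt0.
Qed.

End radial_integral.

Section gamma_law.
Context {R : realType}.
Local Open Scope ereal_scope.
Variable d : nat.
Hypothesis d0 : (0 < d)%N.
Local Notation lambda := (@lebesgue_measure R).
Local Notation lambdad := (@lebesgue_tuple R d).
Local Notation t := (d%:R / 2 : R)%R.

Let t0 : (0 < t)%R. Proof. by rewrite divr_gt0// ltr0n. Qed.

Lemma fine_unit_ball : (fine (lambdad (@unit_ball R d)))%:E = lambdad (@unit_ball R d).
Proof. by rewrite fineK// ge0_fin_numE// unit_ball_lty. Qed.

Lemma gauss_const_ball :
  lambdad (@unit_ball R d) *
  ((@gauss_const R d * t)%:E * \int[lambda]_u (gamma_fun t u)%:E) = 1.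
Proof.
have [sigma sigmaE] := @exists_sphere_measure R d.
by rewrite -(gauss_const_Gamma d0 sigmaE) sigmaE// preimage_setT setIT.
Qed.

Lemma integral_gamma_funT : \int[lambda]_u (gamma_fun t u)%:E = (Gamma t)%:E.
Proof.
have -> : (Gamma t)%:E = (fine (\int[lambda]_u (gamma_fun t u)%:E))%:E.
  by rewrite integral_gamma_fun_itv// setIT.
have := gauss_const_ball; have : 0 <= \int[lambda]_u (gamma_fun t u)%:E.
  by apply: integral_ge0 => u _; rewrite lee_fin gamma_fun_ge0.
(* an infinite Gamma integral would make the left-hand side 0 or infinite *)
case: (integral _ _ _) => [//|_|//]; rewrite gt0_muley; last first.
  by rewrite lte_fin mulr_gt0// gauss_const_gt0.
have : 0 <= lambdad (@unit_ball R d) by exact: measure_ge0.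
rewrite le_eqVlt => /predU1P[<-|s0]; last by rewrite gt0_muley.
by rewrite mul0e => /eqP; rewrite eqe eq_sym oner_eq0.
Qed.

Lemma gauss_const_GammaR :
  (fine (lambdad (@unit_ball R d)) * (@gauss_const R d * t * Gamma t) = 1)%R.
Proof.
have := gauss_const_ball; rewrite -fine_unit_ball integral_gamma_funT -!EFinM.
by case.
Qed.

Lemma Gamma_gt0 : (0 < Gamma t)%R.
Proof.
rewrite lt_neqAle; apply/andP; split.
  apply/eqP => G0; have := gauss_const_GammaR; rewrite -G0 !mulr0.
  by move/esym/eqP; rewrite oner_eq0.
rewrite -lee_fin -integral_gamma_funT.
by apply: integral_ge0 => u _; rewrite lee_fin gamma_fun_ge0.
Qed.

(** The density of the Gamma law of shape [d / 2]. *)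
Definition gamma_density (u : R) : R := (gamma_fun t u / Gamma t)%R.

Lemma gamma_density_gt0 u : (0 < gamma_density u)%R = (0 < u)%R.
Proof.
rewrite /gamma_density pmulr_lgt0 ?invr_gt0 ?Gamma_gt0// /gamma_fun indicE.
have [u0|u0] := ltP 0%R u.
  by rewrite mem_set/= ?in_itv/= ?u0// mul1r mulr_gt0 ?powR_gt0 ?expR_gt0.
by rewrite memNset ?mul0r ?ltxx//= in_itv/= andbT ltNge u0.
Qed.

Lemma ray_density_gamma : ray_density gamma_density.
Proof.
have G0 := Gamma_gt0.
split.
- by apply: measurable_funM => //; exact: measurable_gamma_fun.
- by move=> u; rewrite divr_ge0 ?gamma_fun_ge0// ltW.
- under eq_integral do rewrite EFinM.
  rewrite ge0_integralZr//.
  + by rewrite integral_gamma_funT -EFinM divff// gt_eqF.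
  + by apply/measurable_EFinP; exact: measurable_gamma_fun.
  + by move=> u _; rewrite lee_fin gamma_fun_ge0.
  + by rewrite lee_fin invr_ge0 ltW.
- by move=> x y xy; rewrite !gamma_density_gt0 => /lt_le_trans; apply.
- move=> x; rewrite gamma_density_gt0 => x0; exists (x / 2)%R.
    by rewrite ltr_pdivrMr// ltr_pMr// ltr1n.
  by rewrite gamma_density_gt0 divr_gt0.
Qed.

Lemma distribution_function_gamma u :
  distribution_function gamma_density u = (incomplete_gamma t u / Gamma t)%R.
Proof.
have ig : lambda.-integrable `]-oo, u] (EFin \o gamma_fun t).
  apply: (@integrableS _ _ _ lambda setT) => //.
  apply/integrableP; split; first by apply/measurable_EFinP; exact: measurable_gamma_fun.
  under eq_integral do rewrite /= ger0_norm ?gamma_fun_ge0//.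
  by rewrite integral_gamma_funT ltry.
rewrite /distribution_function RintegralZr//; congr (_ / _)%R.
by rewrite /Rintegral integral_gamma_fun.
Qed.

End gamma_law.

(** * The radial map from the Gaussian law to the ball *)

Section radial_map.
Context {R : realType}.
Variable d : nat.
Hypothesis d0 : (0 < d)%N.
Local Notation t := (d%:R / 2 : R).
Local Notation F := (distribution_function (@gamma_density R d)).
Local Notation Q := (quantile (@gamma_density R d)).
Local Notation lambda := (@lebesgue_measure R).
Local Notation lambdad := (@lebesgue_tuple R d).

Let gP := @ray_density_gamma R d d0.

Let d_gt0 : 0 < d%:R :> R. Proof. by rewrite ltr0n. Qed.

Definition radial_map (y : d.-tuple R) : d.-tuple R :=
  scale (F (enorm y ^+ 2) `^ d%:R^-1) (direction y).

Definition radial_inv (y : d.-tuple R) : d.-tuple R :=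
  scale (Num.sqrt (Q (enorm y ^+ d))) (direction y).

Lemma radial_map0 (y : d.-tuple R) : enorm y = 0 -> radial_map y = y.
Proof. by move=> y0; rewrite /radial_map direction_eq0// scale_eq0. Qed.

Lemma radial_inv0 (y : d.-tuple R) : enorm y = 0 -> radial_inv y = y.
Proof. by move=> y0; rewrite /radial_inv direction_eq0// scale_eq0. Qed.

Let F01 s : 0 < s -> 0 < F s < 1.
Proof.
move=> s0; rewrite distribution_function_gt0 ?distribution_function_lt1//.
by rewrite (gamma_density_gt0 d0).
Qed.

Lemma powRVX (v : R) : 0 <= v -> (v `^ d%:R^-1) ^+ d = v.
Proof. by move=> v0; rewrite -powR_mulrn ?powR_ge0// powRVK. Qed.

Lemma radial_mapK : cancel radial_map radial_inv.
Proof.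
move=> y; have [y0|y0] := eqVneq (enorm y) 0.
  by rewrite radial_map0// radial_inv0.
have s0 : 0 < enorm y ^+ 2 by rewrite exprn_gt0// enorm_gt0.
have /andP[Fs _] := F01 s0.
rewrite /radial_inv /radial_map direction_scale_direction ?powR_gt0//.
rewrite enorm_scale_direction ?powR_ge0// powRVX ?ltW//.
rewrite quantileK// ?(gamma_density_gt0 d0)//.
by rewrite sqrtr_sqr ger0_norm ?enorm_ge0// scale_enorm_direction.
Qed.

Lemma radial_map_ball y : unit_ball (radial_map y).
Proof.
have [y0|y0] := eqVneq (enorm y) 0.
  by rewrite radial_map0// /unit_ball/= y0.
have s0 : 0 < enorm y ^+ 2 by rewrite exprn_gt0// enorm_gt0.
have /andP[F0 F1] := F01 s0.
rewrite /unit_ball/= enorm_scale_direction ?powR_ge0// ltr_powRV ?ler01 ?ltW//.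
by rewrite powR1.
Qed.

Lemma radial_invK y : unit_ball y -> radial_map (radial_inv y) = y.
Proof.
move=> yB; have [y0|y0] := eqVneq (enorm y) 0.
  by rewrite radial_inv0// radial_map0.
have v01 : 0 < enorm y ^+ d < 1.
  by rewrite exprn_gt0 ?enorm_gt0//= exprn_ilt1// ?enorm_ge0// -lt0n.
have [] := quantileP gP v01; rewrite (gamma_density_gt0 d0) => Q0 FQ.
rewrite /radial_map /radial_inv direction_scale_direction ?sqrtr_gt0//.
rewrite enorm_scale_direction ?sqrtr_ge0// sqr_sqrtr ?ltW// FQ.
by rewrite -powR_mulrn ?enorm_ge0// powRK ?enorm_ge0// scale_enorm_direction.
Qed.

Lemma phi_ball_scale y : phi_ball (scale (Num.sqrt 2) y) = radial_map y.
Proof.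
rewrite /phi_ball; have s2 : 0 < Num.sqrt 2 :> R by rewrite sqrtr_gt0.
case: eqP => [y0|y0].
  have : enorm (scale (Num.sqrt 2) y) = 0 by rewrite y0 enorm0.
  rewrite enorm_scale ?ltW// => /eqP; rewrite mulf_eq0 gt_eqF//= => /eqP {}y0.
  by rewrite radial_map0//; exact/esym/enorm_eq0.
apply: eq_from_tnth => i; rewrite tnth_mktuple !tnth_scale enorm_scale ?ltW//.
have -> : (Num.sqrt 2 * enorm y) ^+ 2 / 2 = enorm y ^+ 2.
  by rewrite exprMn sqr_sqrtr// mulrAC divff ?mul1r.
rewrite -(distribution_function_gamma d0).
by rewrite invfM mulrACA divff ?gt_eqF// mul1r mulrC [tnth y i / _]mulrC.
Qed.

Let measurable_F := measurable_distribution_function gP.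

Lemma measurable_radial_map : measurable_fun setT radial_map.
Proof.
have H : measurable_fun setT (fun y : d.-tuple R =>
    (F (enorm y ^+ 2) `^ d%:R^-1 : measurableTypeR R, direction y)).
  apply: measurable_fun_pair; last exact: measurable_direction.
  apply: (measurableT_comp (measurable_powR _)).
  apply: (measurableT_comp measurable_F).
  by apply: measurable_funX; exact: measurable_enorm.
exact: measurableT_comp measurable_scale H.
Qed.

Lemma measurable_radial_inv : measurable_fun setT radial_inv.
Proof.
have H : measurable_fun setT (fun y : d.-tuple R =>
    (Num.sqrt (Q (enorm y ^+ d)) : measurableTypeR R, direction y)).
  apply: measurable_fun_pair; last exact: measurable_direction.
  have ms : measurable_fun setT (@Num.sqrt R).
    by apply: continuous_measurable_fun; exact: sqrt_continuous.
  exact: (measurableT_comp ms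
    (measurableT_comp (measurable_quantile gP) (@measurable_enormX R d))).
exact: measurableT_comp measurable_scale H.
Qed.

(** In polar coordinates both sides are, up to the constant, integrals over the
directions [e] of the same one-dimensional integral, that of the indicator of [A]
at [w ^ (1 / d) e] for [w] in the unit interval: on the left this results from the
quantile transform of the Gamma law, on the right from [w = ||y|| ^ d]. *)
Lemma integral_gauss_radial_map A : measurable A ->
  (\int[lambdad]_y ((\1_A (radial_map y))%:E *
     (@gauss_const R d * expR (- enorm y ^+ 2))%:E) =
   (@gauss_const R d * t * Gamma t)%:E * lambdad (A `&` @unit_ball R d))%E.
Proof.
move=> mA; have c0 := ltW (@gauss_const_gt0 R d).
have [mf f0 _ _ _] := gP.
have G0 : 0 < Gamma t := @Gamma_gt0 R d d0.
have [sigma sigmaE] := @exists_sphere_measure R d.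
pose K (z : measurableTypeR R * d.-tuple R) : R := \1_A (scale (z.1 `^ d%:R^-1) z.2).
have K0 z : 0 <= K z by rewrite /K indicE ler0n.
have mK : measurable_fun setT K.
  apply: (measurableT_comp (measurable_indic (D := setT) mA)).
  have H : measurable_fun setT (fun z : measurableTypeR R * d.-tuple R =>
      (z.1 `^ d%:R^-1 : measurableTypeR R, z.2)).
    apply: measurable_fun_pair => //.
    exact: measurableT_comp (measurable_powR _) measurable_fst.
  exact: measurableT_comp measurable_scale H.
pose G (z : measurableTypeR R * d.-tuple R) : \bar R :=
  ((K (F z.1, z.2))%:E * (@gauss_const R d * expR (- z.1))%:E)%E.
have mFz : measurable_fun setT (fun z : measurableTypeR R * d.-tuple R =>
    (F z.1 : measurableTypeR R, z.2)).
  apply: measurable_fun_pair => //.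
  exact: measurableT_comp measurable_F measurable_fst.
have mG : measurable_fun setT G.
  apply: emeasurable_funM; apply/measurable_EFinP.
    exact: measurableT_comp mK mFz.
  apply: measurable_funM => //.
  by apply: measurableT_comp => //; apply: measurableT_comp => //; exact: measurable_fst.
have Gge0 z : (0 <= G z)%E.
  by rewrite mule_ge0// lee_fin// mulr_ge0// expR_ge0.
pose I (z : measurableTypeR R * d.-tuple R) : \bar R :=
  ((K z)%:E * (\1_`]-oo, 1[%classic z.1)%:E)%E.
have mI : measurable_fun setT I.
  apply: emeasurable_funM; apply/measurable_EFinP => //.
  apply: (measurableT_comp _ measurable_fst).
  by apply: measurable_indic; exact: measurable_itv.
have I0 z : (0 <= I z)%E by rewrite mule_ge0// lee_fin// indicE ler0n.
pose J (e : d.-tuple R) : \bar R :=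
  (\int[lambda]_w (I (w, e) * (\1_(`]0%R, +oo[%classic : set R) w)%:E))%E.
transitivity (\int[lambdad]_y G (enorm y ^+ 2, direction y)%R)%E.
  by apply: eq_integral => y _.
rewrite (integral_radial d0 sigmaE mG Gge0).
have -> : lambdad (A `&` @unit_ball R d) = (\int[sigma]_e J e)%E.
  rewrite -(integral_polar d0 sigmaE mI I0).
  rewrite -[X in lambdad X]setIT -integral_indic//; last first.
    by apply: measurableI => //; exact: measurable_unit_ball.
  apply: eq_integral => y _; rewrite /I /K/= -EFinM; congr EFin.
  rewrite -powR_mulrn ?enorm_ge0// powRK ?enorm_ge0// scale_enorm_direction.
  rewrite powR_mulrn ?enorm_ge0// indicI/=; congr (_ * _).
  rewrite !indicE; congr (_%:R); congr nat_of_bool.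
  apply/idP/idP; rewrite !inE/= in_itv/=.
    by move=> yB; rewrite exprn_ilt1// ?enorm_ge0// -lt0n.
  move=> yd; rewrite /unit_ball/= ltNge; apply/negP => y1.
  by move: yd; rewrite ltNge exprn_ege1.
have J0 e : (0 <= J e)%E.
  by apply: integral_ge0 => w _; rewrite mule_ge0// lee_fin indicE ler0n.
rewrite -ge0_integralZl//; last 2 first.
- apply: (@measurable_fun_fubini_tonelli_G _ _ _ _ _ lambda
    (fun z => I z * (\1_(`]0%R, +oo[%classic : set R) z.1)%:E)%E).
    apply: emeasurable_funM => //; apply/measurable_EFinP.
    apply: (measurableT_comp _ measurable_fst).
    by apply: measurable_indic; exact: measurable_itv.
  by move=> z; rewrite mule_ge0// lee_fin indicE ler0n.
- by rewrite lee_fin !mulr_ge0// ltW.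
apply: eq_integral => e _.
have mKe : measurable_fun setT (fun w : measurableTypeR R => (K (w, e))%:E).
  by apply/measurable_EFinP; apply: measurableT_comp => //; exact: measurable_pair2.
transitivity (\int[lambda]_u ((@gauss_const R d * t * Gamma t)%:E *
    ((K (F u, e))%:E * (@gamma_density R d u)%:E)))%E.
  apply: eq_integral => u _; rewrite /G/= -!EFinM; congr EFin.
  rewrite /gamma_density /power_density /gamma_fun; field.
  by rewrite gt_eqF.
have mKFe : measurable_fun setT (fun w : measurableTypeR R => (K (F w, e))%:E).
  exact: measurableT_comp mKe measurable_F.
rewrite ge0_integralZl//; last 3 first.
- by apply: emeasurable_funM => //; apply/measurable_EFinP.
- by move=> u _; rewrite mule_ge0// lee_fin.
- by rewrite lee_fin !mulr_ge0// ltW.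
congr (_ * _)%E.
rewrite -(transports_quantile gP (g := fun u => (K (F u, e))%:E))//; last first.
  by move=> y; rewrite lee_fin.
rewrite /J; apply: (@eq_integral _ (measurableTypeR R) R lambda setT) => v _.
have E01 : \1_`]0, 1[ v = \1_`]-oo, 1[ v * \1_`]0, +oo[ v :> R.
  by rewrite !indicE -natrM mulnb !mem_setE !in_itv/= andbT andbC.
rewrite /I/= -muleA [X in _ = (_ * X)%E](_ : _ = (\1_`]0, 1[ v)%:E); last first.
  by rewrite E01 EFinM.
rewrite indicE mem_setE in_itv/=.
have [v01|_] := boolP (0 < v < 1); last by rewrite !mule0.
by have [_ ->] := quantileP gP v01.
Qed.

End radial_map.

(** * The map from the cube to the ball *)

Section cube_to_ball.
Context {R : realType}.
Variable d : nat.
Hypothesis d0 : (0 < d)%N.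
Local Notation lambdad := (@lebesgue_tuple R d).
Local Notation cube := (@unit_cube R d).
Local Notation ball := (@unit_ball R d).
Local Notation Qg := (quantile (@gauss_density R)).
Local Notation Fg := (distribution_function (@gauss_density R)).

Let gP := @ray_density_gauss R.

Lemma Phi_R_quantile x : cube x -> Phi_R x = scale (Num.sqrt 2) (map_tuple Qg x).
Proof.
move=> xU; apply: eq_from_tnth => i.
by rewrite tnth_mktuple tnth_scale tnth_map erfinv_quantile//; exact: xU.
Qed.

Lemma map_quantileK x : cube x -> map_tuple Fg (map_tuple Qg x) = x.
Proof.
move=> xU; apply: eq_from_tnth => i; rewrite !tnth_map.
by have [] := quantileP gP (xU i).
Qed.

Lemma map_distribution_functionK (y : d.-tuple R) :
  map_tuple Qg (map_tuple Fg y) = y.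
Proof.
apply: eq_from_tnth => i; rewrite !tnth_map quantileK//.
exact: gauss_density_gt0.
Qed.

Lemma map_distribution_function_cube (y : d.-tuple R) : cube (map_tuple Fg y).
Proof.
move=> i; rewrite tnth_map distribution_function_gt0 ?gauss_density_gt0//.
by rewrite distribution_function_lt1.
Qed.

Definition cube_to_ball (x : d.-tuple R) : d.-tuple R := radial_map (map_tuple Qg x).

Definition ball_to_cube (y : d.-tuple R) : d.-tuple R := map_tuple Fg (radial_inv y).

Lemma phi_ball_Phi_R x : cube x -> phi_ball (Phi_R x) = cube_to_ball x.
Proof. by move=> xU; rewrite Phi_R_quantile// phi_ball_scale. Qed.

Lemma cube_to_ballK x : cube x -> ball_to_cube (cube_to_ball x) = x.
Proof. by move=> xU; rewrite /ball_to_cube radial_mapK// map_quantileK. Qed.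

Lemma ball_to_cubeK y : ball y -> cube_to_ball (ball_to_cube y) = y.
Proof.
by move=> yB; rewrite /cube_to_ball map_distribution_functionK radial_invK.
Qed.

Lemma measurable_cube_to_ball : measurable_fun setT cube_to_ball.
Proof.
apply: (measurableT_comp (measurable_radial_map d0)).
by apply: measurable_map_tuple; exact: measurable_quantile gP.
Qed.

Lemma measurable_ball_to_cube : measurable_fun setT ball_to_cube.
Proof.
apply: (measurableT_comp _ (measurable_radial_inv d0)).
by apply: measurable_map_tuple; exact: measurable_distribution_function gP.
Qed.

(** Up to a constant, [integral_gauss_radial_map] and [integral_cube_gauss] give the
identity; [gauss_const_GammaR] says that the constant is the inverse of the volume
of the ball. *)
Lemma unif_ball_preimage A : measurable A ->
  @unif_ball R d A = lambdad (cube `&` cube_to_ball @^-1` A).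
Proof.
move=> mA; have CE := @gauss_const_GammaR R d d0.
have := integral_gauss_radial_map d0 mA.
set C := (_ * Gamma _)%R in CE *.
move=> HA; rewrite setIC.
have mpreA : measurable (cube_to_ball @^-1` A).
  by rewrite -[X in measurable X]setTI; exact: measurable_cube_to_ball.
transitivity (\int[lambdad]_(x in cube) (\1_(cube_to_ball @^-1` A) x)%:E)%E;
  last by rewrite integral_indic//; exact: measurable_unit_cube.
have mAr : measurable_fun setT (fun y : d.-tuple R => (\1_A (radial_map y))%:E : \bar R).
  apply/measurable_EFinP; apply: (measurableT_comp (measurable_indic (D := setT) mA)).
  exact: measurable_radial_map.
transitivity (C%:E * lambdad (A `&` ball))%E.
  rewrite /unif_ball muleC -fine_unit_ball; congr (_ * _)%E.
  have s0 : fine (lambdad ball) != 0.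
    apply/eqP => s0; move: CE; rewrite s0 mul0r => /eqP.
    by rewrite eq_sym oner_eq0.
  by rewrite inver (negbTE s0); congr EFin; apply: (mulfI s0); rewrite CE divff.
rewrite -HA -(integral_cube_gauss mAr); last by move=> y; rewrite lee_fin indicE.
by apply: eq_integral => x _; rewrite !indicE.
Qed.

End cube_to_ball.

Theorem proposition1p2 (R : realType) (d : nat) (hd : (1 <= d)%N) :
  measure_preserving
    (@unit_cube R d) (@lebesgue_tuple R d)
    (@unit_ball R d) (@unif_ball R d)
    (@phi_ball R d \o @Phi_R R d).
Proof.
have phiE := @phi_ball_Phi_R R d hd.
have phi_inj : {in @unit_cube R d &, injective (@phi_ball R d \o @Phi_R R d)}.
  move=> x y; rewrite !inE => xU yU /=; rewrite !phiE// => fxy.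
  by rewrite -(cube_to_ballK hd xU) fxy cube_to_ballK.
have gU (y : d.-tuple R) : unit_cube (ball_to_cube y).
  exact: map_distribution_function_cube.
split.
- by split; [exact: measurable_unit_cube|exact: measurable_unit_ball].
- split.
  + by move=> x xU; rewrite /= phiE//; exact: radial_map_ball.
  + exact: phi_inj.
  + by move=> y yB; exists (ball_to_cube y); rewrite //= phiE// ball_to_cubeK.
- apply: (eq_measurable_fun (@cube_to_ball R d)).
    by move=> x; rewrite inE => xU; rewrite /= phiE.
  by apply: measurable_funTS; exact: measurable_cube_to_ball.
- apply: (eq_measurable_fun (@ball_to_cube R d)); last first.
    by apply: measurable_funTS; exact: measurable_ball_to_cube.
  move=> y; rewrite inE => yB.
  rewrite -[in RHS](ball_to_cubeK hd yB) -phiE//; apply/esym.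
  by apply: (pinvKV _ phi_inj); rewrite inE.
- move=> A mA AB; rewrite unif_ball_preimage//; congr (lebesgue_tuple _).
  by apply/seteqP; split => x [xU Afx]; split => //; move: Afx; rewrite /= phiE.
Qed.
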